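(* Let $1\le p<\infty$, and let $E$ be a Banach space. The following conditions are equivalent: (a) $E$ is reflexive; (b) $f_\mu^p\in H_{w^*}[E]$ for every $\mu\in C(B_{E^{**}})^*_+$; (c) $H^p[E]=J_{w^*}^p[E]$; (d) $H^p[E]=\overline{J_{w^*}^p[E]}$; (e) $f_\mu^p\in M_{w^*,0}^p[E]$ for every $\mu\in C(B_{E^{**}})^*_+$.
   Context: All Banach spaces are real. Let $E$ be a Banach space with dual $E^*$ and bidual $E^{**}$; $B_{E^*}$ and $B_{E^{**}}$ are the closed unit balls of $E^*$ and $E^{**}$. A function $f\colon E^*\to\mathbb{R}$ is positively homogeneous if $f(\lambda x^* )=\lambda f(x^* )$ for all $x^*\in E^*$ and $\lambda\in[0,\infty)$. $H[E]$ is the vector lattice of all positively homogeneous functions $E^*\to\mathbb{R}$ with pointwise operations. For $x_1^*,\dots,x_n^*\in E^*$, set $\|(x_j^* )_{j=1}^n\|_{p,\mathrm{weak}}=\sup_{\|x\|\le1}\bigl(\sum_{j=1}^n|x_j^*(x)|^p\bigr)^{1/p}$, and for $f\in H[E]$ set $\|f\|_{\mathrm{FBL}^p[E]}=\sup\bigl\{\bigl(\sum_{j=1}^n|f(x_j^* )|^p\bigr)^{1/p}: n\in\mathbb{N},\ (x_j^* )_{j=1}^n\subset E^*,\ \|(x_j^* )_{j=1}^n\|_{p,\mathrm{weak}}\le1\bigr\}\in[0,\infty]$. - $H^p[E]=\{f\in H[E]:\|f\|_{\mathrm{FBL}^p[E]}<\infty\}$, a Banach lattice in the norm $\|\cdot\|_{\mathrm{FBL}^p[E]}$.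 - $H_{w^*}[E]=\{f\in H[E]: f|_{B_{E^*}}\text{ is weak*-continuous}\}$. - $H_{w^*}^p[E]=H^p[E]\cap H_{w^*}[E]$. - $J_{w^*}^p[E]$ is the (order) ideal of $H^p[E]$ generated by $H_{w^*}^p[E]$, and $\overline{J_{w^*}^p[E]}$ is its closure in the norm $\|\cdot\|_{\mathrm{FBL}^p[E]}$. - $M_{w^*,0}^p[E]=\{f\in H^p[E]: f|_{B_{E^*}}\text{ is weak*-continuous at }0\}$. Equip $B_{E^{**}}$ with the relative weak* topology. $C(B_{E^{**}})^*_+$ is the set of positive functionals on $C(B_{E^{**}})$, identified with positive Radon measures on $B_{E^{**}}$. For $\mu\in C(B_{E^{**}})^*_+$, the function $f_\mu^p\colon E^*\to\mathbb{R}$ is defined by $f_\mu^p(x^* )=\bigl(\int_{B_{E^{**}}}|x^{**}(x^* )|^p\,d\mu(x^{**})\bigr)^{1/p}$ for $x^*\in E^*$; it belongs to $H^p[E]$. *)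

(* Defs.v *)
From HB Require Import structures.
From mathcomp Require Import all_boot all_order all_algebra.
From mathcomp Require Import all_classical all_reals all_analysis.

Set Implicit Arguments.
Unset Strict Implicit.
Unset Printing Implicit Defensive.

Import Order.TTheory GRing.Theory Num.Theory.
Import numFieldNormedType.Exports.

Local Open Scope classical_set_scope.
Local Open Scope ring_scope.

Definition unit_ball (R : numDomainType) (V : normedModType R) : set V :=
  [set x | `|x| <= 1].
Arguments unit_ball {R} V.

Section dual_space.
Context {R : realType} (V : normedModType R).

Definition dual_pred : {pred V -> R^o} :=
  mem [set f : V -> R^o | linear f /\ continuous f].

Record dual := Dual { dual_fun :> V -> R^o; dual_funP : dual_fun \in dual_pred }.

HB.instance Definition _ := [isSub for dual_fun].
HB.instance Definition _ := [Choice of dual by <:].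

Lemma dual_submod_closed : submod_closed dual_pred.
Proof.
split=> [|a f g].
  apply/mem_set; split=> [k x y|]; last exact: cst_continuous.
  by rewrite /= scaler0 addr0.
move=> /set_mem[lf cf] /set_mem[lg cg].
apply/mem_set; split=> [k x y|x].
  have E z : (a *: f + g) z = a *: f z + g z by [].
  by rewrite !E (lf k x y) (lg k x y) !scalerDr !scalerA (mulrC a k) addrACA.
exact: (cvgD (cvgZl_tmp (cf x)) (cg x)).
Qed.

HB.instance Definition _ :=
  GRing.isSubmodClosed.Build R (V -> R^o) dual_pred dual_submod_closed.

HB.instance Definition _ := [SubChoice_isSubLmodule of dual by <:].

Lemma dual_linear (f : dual) : linear f.
Proof. by case: f => f /= /set_mem[]. Qed.

HB.instance Definition _ (f : dual) :=
  GRing.isLinear.Build R V R^o *:%R (dual_fun f) (dual_linear f).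

Lemma dual_continuous (f : dual) : continuous f.
Proof. by case: f => f /= /set_mem[]. Qed.

Definition dual_norm (f : dual) : R := sup [set `|f x| | x in unit_ball V].

Lemma dual_has_sup (f : dual) : has_sup [set `|f x| | x in unit_ball V].
Proof.
split; first by exists `|f 0|, 0 => //; rewrite /unit_ball/= normr0.
have /linear_boundedP/pinfty_ex_gt0[M M0 fM] :=
  proj2 (linear_bounded_continuous f) (@dual_continuous f).
exists M => _ [x x1 <-]; rewrite (le_trans (fM x))//.
by rewrite -[leRHS]mulr1 ler_wpM2l// ltW.
Qed.

Lemma dual_norm_ub (f : dual) x : `|x| <= 1 -> `|f x| <= dual_norm f.
Proof. by move=> x1; apply: (sup_upper_bound (dual_has_sup f)); exists x. Qed.

Lemma dual_norm_le (f : dual) M :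
  (forall x, `|x| <= 1 -> `|f x| <= M) -> dual_norm f <= M.
Proof.
move=> fM; apply: ge_sup; first by have [] := dual_has_sup f.
by move=> _ [x x1 <-]; exact: fM.
Qed.

Lemma dual_normP (f : dual) x : `|f x| <= dual_norm f * `|x|.
Proof.
have [->|x0] := eqVneq x 0; first by rewrite linear0 !normr0 mulr0.
have nx0 : 0 < `|x| by rewrite normr_gt0.
have : `|f (`|x|^-1 *: x)| <= dual_norm f by rewrite dual_norm_ub// normfZV.
rewrite linearZ normrZ ger0_norm ?invr_ge0//.
by rewrite ler_pdivrMl// mulrC.
Qed.

Lemma dual_norm0_eq0 (f : dual) : dual_norm f = 0 -> f = 0.
Proof.
move=> f0; apply/val_inj/funext => x /=; apply/eqP.
by rewrite -normr_le0 (le_trans (dual_normP f x))// f0 mul0r.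
Qed.

Lemma dual_norm_triangle (f g : dual) :
  dual_norm (f + g) <= dual_norm f + dual_norm g.
Proof.
apply: dual_norm_le => x x1; rewrite (le_trans (ler_normD _ _))//.
by rewrite lerD// dual_norm_ub.
Qed.

Lemma dual_normZ (a : R) (f : dual) : dual_norm (a *: f) = `|a| * dual_norm f.
Proof.
apply/eqP; rewrite eq_le; apply/andP; split.
  apply: dual_norm_le => x x1.
  by rewrite [leLHS]normrZ ler_wpM2l// dual_norm_ub.
have [->|a0] := eqVneq a 0.
  rewrite normr0 mul0r (le_trans (normr_ge0 ((0 *: f : dual) 0)))//.
  by rewrite dual_norm_ub// normr0.
rewrite -ler_pdivlMl ?normr_gt0//; apply: dual_norm_le => x x1.
rewrite ler_pdivlMl ?normr_gt0// -normrZ.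
exact: (@dual_norm_ub (a *: f)).
Qed.

HB.instance Definition _ := Lmodule_isNormed.Build R dual
  dual_norm_triangle dual_normZ dual_norm0_eq0.

End dual_space.
Arguments dual_pred {R} V.


Section bidual.
Context {R : realType} (V : normedModType R).

Definition eval_at (x : V) : dual V -> R^o := fun f => f x.

Lemma eval_at_dual (x : V) : eval_at x \in dual_pred (dual V).
Proof.
have lx : linear (eval_at x) by [].
apply/mem_set; split=> //.
pose e : {linear dual V -> R^o} := HB.pack (eval_at x)
  (GRing.isLinear.Build _ _ _ _ _ lx).
apply: (@bounded_linear_continuous _ _ _ e); apply/linear_boundedP.
exists `|x|; split; first exact: num_real.
move=> M /ltW xM f; rewrite (le_trans (dual_normP f x))// mulrC.
by apply: (@ler_wpM2r _ `|f|).
Qed.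

Definition bidual_embedding (x : V) : dual (dual V) := Dual (eval_at_dual x).

Definition reflexive_space := range bidual_embedding = [set: dual (dual V)].

End bidual.

(* [weakstar V] is the dual of [V] with the topology of pointwise convergence
   on [V], whereas [dual V] itself carries the norm topology. *)
Definition weakstar (R : realType) (V : normedModType R) : Type := dual V.

HB.instance Definition _ (R : realType) (V : normedModType R) :=
  Pointed.copy (weakstar V) (dual V).
HB.instance Definition _ (R : realType) (V : normedModType R) :=
  Topological.copy (weakstar V)
    (initial_topology (fun f : dual V => (dual_fun f : {ptws V -> R}))).

(* The closed unit ball of the dual of [V], with the relative weak* topology. *)
Definition dual_ball (R : realType) (V : normedModType R) : Type :=
  set_type (unit_ball (dual V) : set (weakstar V)).

Lemma dual_ball0_subproof (R : realType) (V : normedModType R) :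
  (0 : dual V) \in (unit_ball (dual V)).
Proof. by apply/mem_set; rewrite /unit_ball /= normr0. Qed.

Definition dual_ball0 (R : realType) (V : normedModType R) : dual_ball V :=
  SigSub (dual_ball0_subproof V).

Definition dual_ball_val (R : realType) (V : normedModType R)
  (z : dual_ball V) : dual V := set_val z.

HB.instance Definition _ (R : realType) (V : normedModType R) :=
  Topological.copy (dual_ball V)
    (set_type (unit_ball (dual V) : set (weakstar V))).
HB.instance Definition _ (R : realType) (V : normedModType R) :=
  isPointed.Build (dual_ball V) (dual_ball0 V).

Definition borel (T : ptopologicalType) := g_sigma_algebraType (@open T).

(* Since [dual_ball V] is compact Hausdorff, its positive Radon measures are the
   finite Borel measures that are inner regular for compact sets; by the Riesz
   theorem they are the positive functionals on the continuous functions. *)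
Definition radon (R : realType) (T : ptopologicalType)
    (mu : {finite_measure set (borel T) -> \bar R}) : Prop :=
  forall A : set (borel T), measurable A ->
    mu A = ereal_sup [set mu K | K in [set K : set T | compact K /\ K `<=` A]].

Section order_ideals.
Context {R : realType} {T : Type}.

Definition order_ideal (L I : set (T -> R)) : Prop :=
  [/\ I `<=` L,
      I (cst 0),
      forall f g, I f -> I g -> I (f \+ g),
      forall (a : R) f, I f -> I (fun x => a * f x) &
      forall f g, L f -> I g -> (forall x, `|f x| <= `|g x|) -> I f].

Definition order_ideal_generated (L S : set (T -> R)) : set (T -> R) :=
  smallest (order_ideal L) S.

End order_ideals.

Section FBL.
Context {R : realType} (p : R) (E : normedModType R).

Definition weak_pnorm n (x : 'I_n -> dual E) : \bar R :=
  ereal_sup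
    [set ((\sum_(j < n) `|x j v| `^ p) `^ p^-1)%:E | v in unit_ball E].

Definition FBL_norm (f : dual E -> R) : \bar R :=
  ereal_sup [set y | exists n (x : 'I_n -> dual E),
    (weak_pnorm x <= 1)%E /\
    y = ((\sum_(j < n) `|f (x j)| `^ p) `^ p^-1)%:E].

Definition pos_homogeneous : set (dual E -> R) :=
  [set f | forall (l : R) (x : dual E), 0 <= l -> f (l *: x) = l * f x].

Definition Hp : set (dual E -> R) :=
  [set f | pos_homogeneous f /\ (FBL_norm f < +oo)%E].

Definition Hw : set (dual E -> R) :=
  [set f | pos_homogeneous f /\ continuous (f \o @dual_ball_val R E)].

Definition Hpw : set (dual E -> R) := Hp `&` Hw.

Definition Jpw : set (dual E -> R) := order_ideal_generated Hp Hpw.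

Definition FBL_closure (A : set (dual E -> R)) : set (dual E -> R) :=
  [set f | Hp f /\ forall e : R, 0 < e ->
    exists2 g, A g & (FBL_norm (f \- g)%R < e%:E)%E].

Definition Mpw0 : set (dual E -> R) :=
  [set f | Hp f /\ {for dual_ball0 E, continuous (f \o @dual_ball_val R E)}].

Definition fmu (mu : {measure set (borel (dual_ball (dual E))) -> \bar R})
    : dual E -> R :=
  fun x => (\int[mu]_z (`|dual_ball_val z x| `^ p)) `^ p^-1.

End FBL.

Arguments pos_homogeneous {R} E.
Arguments Hp {R} p E.
Arguments Hw {R} E.
Arguments Hpw {R} p E.
Arguments Jpw {R} p E.
Arguments Mpw0 {R} p E.
Arguments fmu {R} p {E} mu.

(* Main.v *)
Require Import Defs.
From HB Require Import structures.
From mathcomp Require Import all_boot all_order all_algebra.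
From mathcomp Require Import all_classical all_reals all_analysis.
From mathcomp Require Import measurable_realfun ring lra.

Set Implicit Arguments.
Unset Strict Implicit.
Unset Printing Implicit Defensive.

Import Order.TTheory GRing.Theory Num.Theory.
Import numFieldNormedType.Exports.

Local Open Scope classical_set_scope.
Local Open Scope ring_scope.

(** Why the five conditions are equivalent.  Write [K] for the bidual ball with its
    weak* topology, which is compact by Banach--Alaoglu.  Integration against a
    finite Borel measure on [K] is a positive functional on the continuous functions
    on [K], and for any such functional [L] the function
    [functional_pnorm p L : x |-> L (z |-> |z x|^p)^(1/p)], which is [f_mu^p] when [L]
    is the integral against [mu], belongs to [Hp] ([functional_pnorm_Hp]), because
    the weak [p]-norm of a tuple does not grow when the unit ball is replaced by [K]
    ([weak_pnorm_bidual]).  Working with functionals instead of measures makes the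
    Riesz representation theorem unnecessary.

    Let [E] be reflexive.  If [functional_pnorm p L] were not weak* continuous on the
    dual ball, its control by [x |-> L (z |-> |z x|)] would make the latter bounded
    below on a set having 0 as weak* limit point.  Such a set contains a weak* null
    sequence ([weakstar_null_sequence]); by reflexivity this sequence is pointwise
    null on [K], and bounded convergence for positive functionals
    ([positive_functional_cvg0]) gives a contradiction.  So [functional_pnorm p L] is
    in [Hpw] ([functional_pnorm_Hw]); in particular so is every [f_mu^p].  Since every
    [f] in [Hp] is dominated by one of these functions ([pietsch_domination]), the
    ideal [Jpw] is all of [Hp].

    If [Jpw] is all of [Hp], then so is its closure; and if the closure is all of [Hp],
    then so is [Mpw0], being a norm-closed order ideal that contains [Hpw]
    ([Jpw_sub_Mpw0], [Mpw0_closed]), and [Mpw0] contains every [f_mu^p].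

    Finally let every [f_mu^p] be weak* continuous at 0 on the dual ball.  For the
    Dirac measure at [z] the function is [x |-> |z x|], so every [z] in [K] is weak*
    continuous at 0 on the dual ball.  Then [z] is small on the part of the dual ball
    annihilating some finite set of vectors, and Hahn--Banach puts it at small
    distance from the canonical image of [E] ([bidual_approx]); this image is closed
    since [E] is complete ([range_bidual_closed]), and [E] is reflexive. *)

(** * The Hahn--Banach theorem *)

Section hahn_banach.
Context {R : realType} {V : lmodType R}.

(** Linear subspaces, as classical sets. *)
Definition subspace_set (D : set V) : Prop :=
  [/\ D 0, forall x y, D x -> D y -> D (x + y) &
      forall (a : R) x, D x -> D (a *: x)].

(** Subadditivity and positive homogeneity on a subspace [D].  Only the inequality
    for positive scalars is required: applying it to the inverse scalar gives
    the equality, and it forces the value 0 at 0. *)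
Definition sublinear (D : set V) (q : V -> R) : Prop :=
  (forall x y, D x -> D y -> q (x + y) <= q x + q y) /\
  (forall (t : R) x, 0 < t -> D x -> q (t *: x) <= t * q x).

Variable D : set V.
Hypothesis subD : subspace_set D.

Lemma sublinear0 q : sublinear D q -> q 0 = 0.
Proof.
have [D0 _ _] := subD => -[_ qZ].
have := qZ 2 0 (ltr0n _ 2) D0; have := qZ 2^-1 0 _ D0.
rewrite !scaler0 invr_gt0 ltr0n => /(_ isT) h1 h2; lra.
Qed.

Lemma sublinear_opp q x : sublinear D q -> D x -> - q (- x) <= q x.
Proof.
move=> sq Dx; have [_ _ DZ] := subD.
have DNx : D (- x) by rewrite -scaleN1r; exact: DZ.
by rewrite -subr_ge0 opprK addrC -(sublinear0 sq) -(subrr x) addrC (sq.1 x (- x)).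
Qed.

(** The infimum of a family of sets of upper bounds is sublinear as soon as bounds
    can be added and scaled. *)
Lemma sublinear_inf (S : V -> set R) :
  (forall x, D x -> S x !=set0) -> (forall x, D x -> has_lbound (S x)) ->
  (forall x y a b, D x -> D y -> S x a -> S y b ->
     exists2 c, S (x + y) c & c <= a + b) ->
  (forall t x a, 0 < t -> D x -> S x a -> exists2 c, S (t *: x) c & c <= t * a) ->
  sublinear D (fun x => inf (S x)).
Proof.
move=> S0 lbS SD SZ; have [_ DD DZ] := subD.
split=> [x y Dx Dy|t x t0 Dx].
  rewrite -lerBlDr; apply: (lb_le_inf (S0 _ Dx)) => a Sa.
  rewrite lerBlDr -lerBlDl; apply: (lb_le_inf (S0 _ Dy)) => b Sb.
  rewrite lerBlDl; have [c Sc /(le_trans _)] := SD _ _ _ _ Dx Dy Sa Sb.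
  by apply; apply: ge_inf Sc; exact/lbS/DD.
rewrite -ler_pdivrMl//; apply: (lb_le_inf (S0 _ Dx)) => a Sa.
rewrite ler_pdivrMl//; have [c Sc /(le_trans _)] := SZ _ _ _ t0 Dx Sa.
by apply; apply: ge_inf Sc; exact/lbS/DZ.
Qed.

(** Lowering a sublinear [q] so that every linear functional below the result
    lies above the superlinear [g] on the cone [C]: the functional is
    [x |-> inf_(y in C) (q (x + y) - g y)]. *)
Lemma sublinear_cone q (C : set V) (g : V -> R) :
  sublinear D q -> C `<=` D -> C 0 ->
  (forall x y, C x -> C y -> C (x + y) /\ g x + g y <= g (x + y)) ->
  (forall (t : R) x, 0 < t -> C x -> C (t *: x) /\ t * g x <= g (t *: x)) ->
  (forall x, C x -> g x <= q x) ->
  exists r, [/\ sublinear D r, forall x, D x -> r x <= q x &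
                forall x, C x -> r (- x) <= - g x].
Proof.
move=> sq CD C0 CaddP CscaleP gq; have [_ DD DZ] := subD.
have DN x : D x -> D (- x) by move=> Dx; rewrite -scaleN1r; exact: DZ.
pose S x := [set q (x + y) - g y | y in C].
have lbS x : D x -> has_lbound (S x).
  move=> Dx; exists (- q (- x)) => _ [y Cy <-]; rewrite lerBrDl lerBlDr.
  rewrite (le_trans (gq _ Cy))// -[in leLHS](addrK x y) (addrC y).
  by apply: sq.1; [apply: DD => //; exact: CD|exact: DN].
have g0 : 0 <= g 0.
  have := CscaleP 2^-1 0 _ C0; rewrite scaler0 invr_gt0 ltr0n => /(_ isT)[_]; lra.
exists (fun x => inf (S x)); split.
- apply: sublinear_inf => //.
  + by move=> x _; exists (q (x + 0) - g 0), 0.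
  + move=> x x' _ _ Dx Dx' [y Cy <-] [y' Cy' <-].
    have [Cyy' gyy'] := CaddP _ _ Cy Cy'.
    exists (q (x + x' + (y + y')) - g (y + y')); first by exists (y + y').
    have := sq.1 _ _ (DD _ _ Dx (CD _ Cy)) (DD _ _ Dx' (CD _ Cy')).
    rewrite addrACA; lra.
  + move=> t x _ t0 Dx [y Cy <-]; have [Cty gty] := CscaleP _ _ t0 Cy.
    exists (q (t *: x + t *: y) - g (t *: y)); first by exists (t *: y).
    have := sq.2 _ _ t0 (DD _ _ Dx (CD _ Cy)); rewrite scalerDr mulrBr; lra.
- move=> x Dx; apply: (@le_trans _ _ (q (x + 0) - g 0)).
    by apply: ge_inf; [exact: lbS|exists 0].
  by rewrite addr0 gerBl.
- move=> x Cx; rewrite (_ : - g x = q (- x + x) - g x); last first.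
    by rewrite addNr (sublinear0 sq) sub0r.
  by apply: ge_inf; [exact/lbS/DN/CD|exists x].
Qed.

Lemma minimal_sublinear q : sublinear D q ->
  exists r, [/\ sublinear D r, forall x, D x -> r x <= q x &
    forall s, sublinear D s -> (forall x, D x -> s x <= r x) ->
      forall x, D x -> r x <= s x].
Proof.
move=> sq; pose T := {r : V -> R | sublinear D r /\ forall x, D x -> r x <= q x}.
pose le (r s : T) := `[< forall x, D x -> sval s x <= sval r x >].
have [_ DD DZ] := subD.
have DN x : D x -> D (- x) by move=> Dx; rewrite -scaleN1r; exact: DZ.
have qT : sublinear D q /\ forall x, D x -> q x <= q x by [].
have [] := @ZL_preorder T (exist _ q qT) le.
- by move=> r; apply/asboolP.
- move=> r s t /asboolP sr /asboolP rt; apply/asboolP => x Dx.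
  by rewrite (le_trans (rt _ Dx))// sr.
- move=> A Atot; have [[r0 Ar0]|A0] := pselect (A !=set0); last first.
    by exists (exist _ q qT) => s As; exfalso; apply: A0; exists s.
  pose S x := [set sval r x | r in A].
  have lbS x : D x -> has_lbound (S x).
    move=> Dx; exists (- q (- x)) => _ [[s [ss sq']] As <-] /=.
    by rewrite (le_trans _ (sublinear_opp ss Dx))// lerN2 sq'//; exact: DN.
  have sS : sublinear D (fun x => inf (S x)).
    apply: sublinear_inf => //.
    + by move=> x _; exists (sval r0 x), r0.
    + move=> x y _ _ Dx Dy [r Ar <-] [s As <-].
      (* in a chain one of the two functionals is below the other *)
      have [/asboolP sr|/asboolP rs] := Atot _ _ Ar As.
        exists (sval s (x + y)); first by exists s.
        have [[+ _] _] := svalP s => /(_ _ _ Dx Dy); have := sr _ Dx; lra.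
      exists (sval r (x + y)); first by exists r.
      have [[+ _] _] := svalP r => /(_ _ _ Dx Dy); have := rs _ Dy; lra.
    + move=> t x _ t0 Dx [r Ar <-]; exists (sval r (t *: x)); first by exists r.
      by have [[_ rZ] _] := svalP r; exact: rZ.
  have Sq x : D x -> inf (S x) <= q x.
    move=> Dx; apply: (@le_trans _ _ (sval r0 x)).
      by apply: ge_inf; [exact: lbS|exists r0].
    by have [_ ->] := svalP r0.
  have ST : sublinear D (fun x => inf (S x)) /\ forall x, D x -> inf (S x) <= q x by [].
  exists (exist _ (fun x => inf (S x)) ST) => s As; apply/asboolP => x Dx /=.
  by apply: ge_inf; [exact: lbS|exists s].
- move=> [r rT] rmax; have [sr rq] := rT; exists r; split=> // s ss sr' x Dx.
  have sq' y : D y -> s y <= q y by move=> Dy; rewrite (le_trans (sr' _ Dy))// rq.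
  have sT : sublinear D s /\ forall x, D x -> s x <= q x by [].
  have /rmax/asboolP : le (exist _ r rT) (exist _ s sT).
    by apply/asboolP.
  by apply.
Qed.

(** Hahn--Banach in the form of Mazur and Orlicz: a linear functional between a
    superlinear [g] on a cone and a sublinear [q].  It is obtained as a minimal
    sublinear functional, so no extension of partial functionals is needed. *)
Theorem hahn_banach q (C : set V) (g : V -> R) :
  sublinear D q -> C `<=` D -> C 0 ->
  (forall x y, C x -> C y -> C (x + y) /\ g x + g y <= g (x + y)) ->
  (forall (t : R) x, 0 < t -> C x -> C (t *: x) /\ t * g x <= g (t *: x)) ->
  (forall x, C x -> g x <= q x) ->
  exists f : V -> R,
    [/\ forall x y, D x -> D y -> f (x + y) = f x + f y,
        forall (a : R) x, D x -> f (a *: x) = a * f x,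
        forall x, D x -> f x <= q x & forall x, C x -> g x <= f x].
Proof.
move=> sq CD C0 CaddP CscaleP gq; have [D0 DD DZ] := subD.
have DN x : D x -> D (- x) by move=> Dx; rewrite -scaleN1r; exact: DZ.
have [r [sr rq rg]] := sublinear_cone sq CD C0 CaddP CscaleP gq.
have [f [sf fr fmin]] := minimal_sublinear sr.
have fZpos t x : 0 < t -> D x -> f (t *: x) = t * f x.
  move=> t0 Dx; apply/eqP; rewrite eq_le sf.2//=.
  rewrite -ler_pdivlMl//.
  have {1}-> : x = t^-1 *: (t *: x) by rewrite scalerA mulVf ?gt_eqF// scale1r.
  by apply: sf.2; [rewrite invr_gt0|exact: DZ].
have fZ0 t x : 0 <= t -> D x -> f (t *: x) = t * f x.
  rewrite le_eqVlt => /orP[/eqP <- _|]; last exact: fZpos.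
  by rewrite scale0r mul0r (sublinear0 sf).
(* minimality against the ray through [y] makes [f] superadditive *)
have fD x y : D x -> D y -> f (x + y) = f x + f y.
  move=> Dx Dy; apply/eqP; rewrite eq_le sf.1//=.
  pose Cy := [set t *: y | t in [set t : R | 0 <= t]].
  have [|||||s [ss sf' sy]] := @sublinear_cone f Cy f sf.
  - by move=> _ [t _ <-]; exact: DZ.
  - by exists 0; rewrite ?scale0r//=.
  - move=> _ _ [t /= t0 <-] [t' /= t'0 <-]; rewrite -scalerDl; split.
      by exists (t + t') => //=; exact: addr_ge0.
    by rewrite !fZ0// ?addr_ge0// mulrDl.
  - move=> u _ u0 [t /= t0 <-]; rewrite scalerA; split.
      by exists (u * t) => //=; rewrite mulr_ge0// ltW.
    by rewrite !fZ0// ?mulr_ge0 ?(ltW u0)// mulrA.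
  - by [].
  have fs := fmin _ ss sf'.
  have Cyy : Cy y by exists 1; rewrite ?scale1r//=.
  have := sf.1 _ _ Dx Dy; have := sy _ Cyy.
  have := fs _ (DN _ Dy).
  have := ss.1 _ _ (DD _ _ Dx Dy) (DN _ Dy); rewrite addrK.
  have := fs _ Dx; have := sf' _ (DD _ _ Dx Dy); lra.
have fN x : D x -> f (- x) = - f x.
  move=> Dx; apply/eqP; rewrite -addr_eq0 -fD ?addNr//; last exact: DN.
  by rewrite (sublinear0 sf).
exists f; split=> //.
- move=> a x Dx; have [a0|/ltW a0] := leP 0 a; first exact: fZ0.
  rewrite -[a]opprK scaleNr fN; last exact: DZ.
  by rewrite fZ0 ?mulNr// oppr_ge0.
- by move=> x Dx; rewrite (le_trans (fr _ Dx))// rq.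
- move=> x Cx; have := rg _ Cx; have := fr _ (DN _ (CD _ Cx)).
  rewrite fN; last exact: CD.
  lra.
Qed.

End hahn_banach.

(** * The dual ball with the weak* topology *)

Lemma cvg_initial (S : choiceType) (T : topologicalType) (f : S -> T)
    (F : set_system S) (s : S) : Filter F ->
  f @ F --> f s -> F --> (s : initial_topology f).
Proof.
move=> FF fFs U [_ [[B oB <-] Bfs] BU].
have /fFs FB : nbhs (f s) B by exact: open_nbhs_nbhs.
exact: (filterS BU FB).
Qed.

Section weakstar_ball.
Context {R : realType} {V : normedModType R}.
Implicit Types z u : dual_ball V.

Lemma dual_ball_val_le1 z : `|dual_ball_val z| <= 1.
Proof. exact: (set_valP z). Qed.

(** A functional of norm at most 1, as a point of the dual ball. *)
Definition to_dual_ball (f : dual V) (f1 : `|f| <= 1) : dual_ball V :=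
  SigSub (mem_set f1 : (f : weakstar V) \in (unit_ball (dual V) : set (weakstar V))).

Lemma dual_le1 (f : dual V) v : `|f| <= 1 -> `|v| <= 1 -> `|f v| <= 1.
Proof. by move=> f1 v1; apply: le_trans f1; exact: dual_norm_ub. Qed.

(** Weak* convergence in the dual ball is pointwise convergence. *)
Lemma dual_ballP (F : set_system (dual_ball V)) z : Filter F ->
  (F --> z) <-> (forall v, dual_ball_val u v @[u --> F] --> dual_ball_val z v).
Proof.
move=> FF; split=> [Fz v|Fz].
  have c1 : continuous (fun u : dual_ball V => set_val u : weakstar V).
    exact: initial_continuous.
  have c2 : continuous (fun f : weakstar V => dual_fun f : {ptws V -> R}).
    exact: initial_continuous.
  have c3 : continuous (fun h : {ptws V -> R} => h v).
    exact: (@proj_continuous V (fun=> R) v).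
  apply: (cvg_trans (cvg_app _ Fz)).
  exact: (continuous_comp (c1 z) (continuous_comp (c2 _) (c3 _))).
apply: cvg_initial; apply: cvg_initial => /=.
apply/(@pointwise_cvgP V R _ _ _) => v.
exact: Fz.
Qed.
End weakstar_ball.

(** * Functionals on a normed space and the Banach--Alaoglu theorem *)

Section hahn_banach_corollaries.
Context {R : realType}.

Lemma subspace_setT (V : lmodType R) : subspace_set [set: V].
Proof. by []. Qed.

(** A sublinear functional has a linear minorant touching it at a given point. *)
Corollary hahn_banach_point (V : lmodType R) (q : V -> R) (x0 : V) :
  sublinear setT q ->
  exists f : V -> R, [/\ forall x y, f (x + y) = f x + f y,
    forall a x, f (a *: x) = a * f x, forall x, f x <= q x & f x0 = q x0].
Proof.
move=> sq; have q0 := sublinear0 (subspace_setT V) sq.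
have qZ t x : 0 <= t -> q (t *: x) = t * q x.
  rewrite le_eqVlt => /orP[/eqP <-|t0]; first by rewrite scale0r mul0r q0.
  apply/eqP; rewrite eq_le sq.2//= -ler_pdivlMl//.
  rewrite -[in leLHS](scale1r x) -(mulVf (lt0r_neq0 t0)) -scalerA.
  by apply: sq.2 => //; rewrite invr_gt0.
pose C := [set t *: x0 | t in [set t : R | 0 <= t]].
have [|||||f [fD fZ fq qf]] := @hahn_banach _ _ _ (subspace_setT V) q C q sq.
- by [].
- by exists 0; rewrite ?scale0r//=.
- move=> _ _ [t /= t0 <-] [t' /= t'0 <-]; rewrite -scalerDl; split.
    by exists (t + t') => //=; exact: addr_ge0.
  by rewrite !qZ ?addr_ge0// mulrDl.
- move=> u _ u0 [t /= t0 <-]; rewrite scalerA; split.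
    by exists (u * t) => //=; rewrite mulr_ge0// ltW.
  by rewrite !qZ ?mulr_ge0 ?(ltW u0)// mulrA.
- by [].
exists f; split=> //; [by move=> x y; exact: fD|by move=> a x; exact: fZ|
  by move=> x; exact: fq|].
by apply/eqP; rewrite eq_le fq//= qf//; exists 1; rewrite ?scale1r//=.
Qed.

Context {V : normedModType R}.

Lemma dual_of_bounded (f : V -> R) (M : R) : 0 <= M ->
  (forall x y, f (x + y) = f x + f y) -> (forall a x, f (a *: x) = a * f x) ->
  (forall x, f x <= M * `|x|) ->
  exists2 g : dual V, (forall x, g x = f x) & `|g| <= M.
Proof.
move=> M0 fD fZ fM.
have lf : linear (f : V -> R^o) by move=> a x y; rewrite fD fZ.
have fM' x : `|f x| <= M * `|x|.
  rewrite ler_norml fM andbT lerNl -mulN1r -fZ scaleN1r.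
  by rewrite (le_trans (fM _))// normrN.
pose e : {linear V -> R^o} := HB.pack (f : V -> R^o)
  (GRing.isLinear.Build _ _ _ _ (f : V -> R^o) lf).
have cf : continuous (f : V -> R^o).
  apply: (@bounded_linear_continuous _ _ _ e); apply/linear_boundedP.
  exists M; split; first exact: num_real.
  by move=> N /ltW MN x; rewrite (le_trans (fM' x))// ler_wpM2r.
have df : (f : V -> R^o) \in dual_pred V by apply/mem_set.
exists (Dual df) => //.
apply: dual_norm_le => x x1 /=; rewrite (le_trans (fM' x))//.
by rewrite -[leRHS]mulr1 ler_wpM2l.
Qed.

Lemma sublinear_norm (M : R) : 0 <= M ->
  sublinear setT (fun x : V => M * `|x|).
Proof.
move=> M0; split=> [x y _ _|t x t0 _].
  by rewrite -mulrDr ler_wpM2l// ler_normD.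
by rewrite normrZ gtr0_norm// mulrCA.
Qed.

Lemma dual_norming (x : V) : exists2 f : dual V, `|f| <= 1 & f x = `|x|.
Proof.
have [f [fD fZ fq fx]] := hahn_banach_point x (sublinear_norm ler01).
have [g gf g1] := dual_of_bounded ler01 fD fZ fq.
by exists g => //; rewrite gf fx mul1r.
Qed.

Lemma bidual_embedding_linear : linear (@bidual_embedding R V).
Proof.
by move=> a x y; apply/val_inj/funext => f /=; rewrite /eval_at linearP.
Qed.

Lemma bidual_embedding_norm (x : V) : `|bidual_embedding x| = `|x|.
Proof.
apply/eqP; rewrite eq_le; apply/andP; split.
  apply: dual_norm_le => f f1; rewrite /= /eval_at.
  rewrite (le_trans (dual_normP f x))// -[leRHS]mul1r ler_wpM2r//.
have [f f1 fx] := dual_norming x.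
by have := dual_norm_ub (bidual_embedding x) f1; rewrite /= /eval_at fx normr_id.
Qed.

(** A point at positive distance from a subspace is separated from it. *)
Lemma dual_separation (S : set V) (y : V) (e : R) : subspace_set S -> 0 < e ->
  (forall s, S s -> e <= `|y - s|) ->
  exists f : dual V, (forall s, S s -> f s = 0) /\ f y != 0.
Proof.
move=> [S0 SD SZ] e0 eS; pose Q x := [set `|x - s| | s in S].
have lbQ x : has_lbound (Q x) by exists 0 => _ [s _ <-].
have sq : sublinear setT (fun x => inf (Q x)).
  apply: (sublinear_inf (subspace_setT V)) => //.
  - by move=> x _; exists `|x - 0|, 0.
  - move=> x x' _ _ _ _ [s Ss <-] [s' Ss' <-].
    exists (`|x + x' - (s + s')|); first by exists (s + s') => //; exact: SD.
    by rewrite opprD addrACA ler_normD.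
  - move=> t x _ t0 _ [s Ss <-]; exists (`|t *: x - t *: s|).
      by exists (t *: s) => //; exact: SZ.
    by rewrite -scalerBr normrZ gtr0_norm.
have [f [fD fZ fq fy]] := hahn_banach_point y sq.
have fS s : S s -> f s <= 0.
  move=> Ss; rewrite (le_trans (fq s))//; apply: (ge_inf (lbQ _)).
  by exists s => //; rewrite subrr normr0.
have [|g gf _] := dual_of_bounded ler01 fD fZ.
  move=> x; rewrite mul1r (le_trans (fq x))//; apply: (ge_inf (lbQ _)).
  by exists 0 => //; rewrite subr0.
exists g; split.
  move=> s Ss; rewrite gf; apply/eqP; rewrite eq_le fS//= -oppr_le0.
  by rewrite -mulN1r -fZ scaleN1r fS// -scaleN1r; exact: SZ.
rewrite gf fy gt_eqF// (lt_le_trans e0)//; apply: lb_le_inf.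
  by exists `|y - 0|, 0.
by move=> _ [s Ss <-]; exact: eS.
Qed.

End hahn_banach_corollaries.

Section weakstar_compactness.
Context {R : realType} {V : normedModType R}.

Lemma dual_ball_eval_continuous (v : V) :
  continuous (fun z : dual_ball V => dual_ball_val z v).
Proof. by move=> z; have [+ _] := @dual_ballP R V (nbhs z) z _; apply. Qed.

(** Along an ultrafilter the values at every vector lie in a compact segment, hence
    converge; the limits define a functional of norm at most 1. *)
Theorem banach_alaoglu : compact [set: dual_ball V].
Proof.
rewrite compact_ultra => F FU _.
have lim_ v : exists l : R, dual_ball_val u v @[u --> F] --> l.
  pose G := (fun u => dual_ball_val u v) @ F.
  have GU : UltraFilter G.
    have GP : ProperFilter G by apply: fmap_proper_filter; exact: ultra_proper.
    split=> // H HF GH; apply/seteqP; split=> // A HA.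
    have [//|FA] := in_ultra_setVsetC ((fun u => dual_ball_val u v) @^-1` A) FU.
    have HA' : H (~` A) by exact: GH.
    have H0 : H set0 by rewrite -(setICr A); exact: filterI.
    by case: (@filter_not_empty _ H HF H0).
  have := @segment_compact R (- `|v|) `|v|; rewrite compact_ultra => /(_ G GU).
  case.
    suff : F ((fun u => dual_ball_val u v) @^-1` `[(- `|v|), `|v|]) by [].
    apply: filterE => u /=; rewrite in_itv /= -ler_norml.
    apply: (le_trans (dual_normP (dual_ball_val u) v)); rewrite -[leRHS]mul1r.
    by rewrite ler_wpM2r//; exact: dual_ball_val_le1.
  by move=> l [_ Gl]; exists l.
have [l ll] := choice lim_.
have uniq v (a : R) : dual_ball_val u v @[u --> F] --> a -> l v = a.
  by move=> h; exact: (cvg_unique (@Rhausdorff R) (ll v) h).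
have [|||g gl g1] := @dual_of_bounded _ V l 1 ler01.
- move=> x y; apply: uniq.
  rewrite (_ : (fun u => _) = (fun u => dual_ball_val u x) \+
    (fun u => dual_ball_val u y)); last by apply/funext => u; rewrite linearD.
  exact: cvgD.
- move=> a x; apply: uniq.
  rewrite (_ : (fun u => _) = a \*: (fun u : dual_ball V => dual_ball_val u x : R^o)).
    exact: (cvgZl_tmp (ll x)).
  by apply/funext => u; rewrite linearZ.
- move=> x; apply: (closed_cvg (fun r : R => r <= 1 * `|x|) _ _ _ (ll x)).
    exact: closed_le.
  apply: filterE => u; rewrite (le_trans (ler_norm _))//.
  by rewrite (le_trans (dual_normP _ _))// ler_wpM2r//; exact: dual_ball_val_le1.
exists (to_dual_ball g1); split=> //.
apply/dual_ballP => v; rewrite [dual_ball_val _ v]gl; exact: ll.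
Qed.

(** The basic weak* neighbourhoods are given by finitely many vectors. *)
Lemma dual_ball_nbhs (z : dual_ball V) (U : set (dual_ball V)) : nbhs z U ->
  exists (s : seq V) (e : R), 0 < e /\ forall u : dual_ball V,
    (forall v, v \in s -> `|dual_ball_val z v - dual_ball_val u v| < e) -> U u.
Proof.
pose B (i : seq V * R) := [set u : dual_ball V | forall v, v \in i.1 ->
   `|dual_ball_val z v - dual_ball_val u v| < i.2].
pose G := filter_from [set i : seq V * R | 0 < i.2] B.
have GF : Filter G.
  apply: filter_from_filter; first by exists ([::], 1) => /=.
  move=> [s e] [s' e'] /= e0 e'0; exists (s ++ s', Num.min e e') => /=.
    by rewrite lt_min e0.
  move=> u /= Bu; split=> v /= vs; have := Bu v; rewrite mem_cat vs ?orbT /=;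
    by move=> /(_ isT); rewrite lt_min => /andP[].
have Gz : G --> z.
  apply/dual_ballP => v; apply/cvgrPdist_lt => e e0.
  by exists ([:: v], e) => //= u; apply; rewrite inE.
by move=> /Gz[[s e] /= e0 BU]; exists s, e; split=> // u Bu; exact: BU.
Qed.

End weakstar_compactness.

(** * Powers, weak p-norms and the norm of FBL *)

Section powR_inequalities.
Context {R : realType} (p : R).
Hypothesis p1 : 1 <= p.

Let p0 : 0 < p. Proof. exact: lt_le_trans ltr01 p1. Qed.
Let pn0 : p != 0. Proof. by rewrite gt_eqF. Qed.

Lemma powR1r (r : R) : 1 `^ r = 1.
Proof. by rewrite powR1. Qed.

Lemma powRVK (a : R) : 0 <= a -> (a `^ p^-1) `^ p = a.
Proof. by move=> a0; rewrite -powRrM mulVf// powRr1. Qed.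

Lemma powRKV (a : R) : 0 <= a -> (a `^ p) `^ p^-1 = a.
Proof. by move=> a0; rewrite -powRrM mulfV// powRr1. Qed.

Lemma ler_powRp (a b : R) : 0 <= a -> a <= b -> a `^ p <= b `^ p.
Proof.
move=> a0 ab; apply: ge0_ler_powR => //; rewrite ?nnegrE ?(ltW p0)//.
exact: le_trans ab.
Qed.

Lemma powRV_le (a c : R) : 0 <= a -> 0 <= c -> (a `^ p^-1 <= c) = (a <= c `^ p).
Proof.
move=> a0 c0; apply/idP/idP => h.
  by rewrite -(powRVK a0); apply: ler_powRp => //; exact: powR_ge0.
rewrite -[leRHS]powRKV//; apply: ge0_ler_powR => //.
- by rewrite invr_ge0 ltW.
- by rewrite nnegrE powR_ge0.
Qed.

Lemma sum_powR_ge0 n (F : 'I_n -> R) : 0 <= \sum_(j < n) F j `^ p.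
Proof. by apply: sumr_ge0 => j _; exact: powR_ge0. Qed.

(** Young's inequality for the conjugate exponents [p] and [p / (p - 1)], in a form
    that also covers [p = 1]. *)
Lemma young_powR (a t : R) : 0 <= a -> 0 <= t ->
  p * (t * a `^ (p - 1)) <= t `^ p + (p - 1) * a `^ p.
Proof.
move=> a0 t0; have [->|pne1] := eqVneq p 1.
  by rewrite subrr powRr0 mulr1 mul1r mul0r addr0 powRr1.
have p11 : 0 < p - 1 by rewrite subr_gt0 lt_neqAle eq_sym pne1.
have := @conjugate_powR R t (a `^ (p - 1)) p (p / (p - 1)) t0 (powR_ge0 _ _) p0.
rewrite divr_gt0// -powRrM mulrCA mulfV ?gt_eqF// mulr1 => /(_ isT).
have -> : p^-1 + (p / (p - 1))^-1 = 1 by field; rewrite pn0 gt_eqF.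
move=> /(_ erefl) h; have := ler_wpM2l (ltW p0) h.
suff -> : p * (t `^ p / p + a `^ p / (p / (p - 1))) = t `^ p + (p - 1) * a `^ p.
  by [].
by field; rewrite pn0 gt_eqF.
Qed.

Lemma powR_lipschitz (M a t : R) : 0 <= a <= M -> 0 <= t <= M ->
  `|a `^ p - t `^ p| <= p * M `^ (p - 1) * `|a - t|.
Proof.
wlog at_ : a t / t <= a => [wl ha ht|].
  have [ta|/ltW at_] := leP t a; first exact: wl.
  by rewrite distrC (distrC a); exact: wl.
move=> /andP[a0 aM] /andP[t0 _].
have tap := ler_powRp t0 at_.
rewrite !ger0_norm ?subr_ge0//.
have := young_powR a0 t0; rewrite -(mulr_powRB1 a0 p0).
have : a `^ (p - 1) <= M `^ (p - 1).
  by apply: ge0_ler_powR; rewrite ?nnegrE ?subr_ge0 ?(le_trans a0 aM).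
set N := M `^ (p - 1); set b := a `^ (p - 1) => bN h.
have : 0 <= p * ((a - t) * (N - b)).
  by rewrite mulr_ge0 ?(ltW p0)// mulr_ge0// subr_ge0.
lra.
Qed.

Lemma powR_add_le (a b : R) :
  `|a + b| `^ p <= 2 `^ p * (`|a| `^ p + `|b| `^ p).
Proof.
wlog ab : a b / `|a| <= `|b| => [wl|].
  have [|/ltW] := leP `|a| `|b|; first exact: wl.
  by move=> /wl; rewrite addrC (addrC (`|b| `^ p)).
apply: (@le_trans _ _ ((2 * `|b|) `^ p)).
  by apply: ler_powRp => //; have := ler_normD a b; lra.
rewrite powRM// ler_wpM2l ?powR_ge0// lerDr; exact: powR_ge0.
Qed.

Lemma continuous_norm_powR : continuous (fun t : R => `|t| `^ p).
Proof.
move=> t; apply/cvgrPdist_lt => e e0.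
pose M := `|t| + 1; pose C := p * M `^ (p - 1) + 1.
have C0 : 0 < C.
  by rewrite ltr_wpDl// mulr_ge0 ?powR_ge0// (le_trans ler01 p1).
have eC : 0 < e / C by rewrite divr_gt0.
near=> u.
have ut : `|t - u| < Num.min 1 (e / C).
  near: u; apply: cvgr_dist_lt; first exact: cvg_id.
  by rewrite lt_min ltr01 eC.
move: ut; rewrite lt_min => /andP[ut1 ut2].
have uM : `|u| <= M by have := ler_normD t (u - t); rewrite subrKC distrC /M; lra.
have := @powR_lipschitz M `|t| `|u|; rewrite !normr_ge0 uM lerDl ler01.
move=> /(_ isT isT)/le_lt_trans; apply.
apply: (@le_lt_trans _ _ (C * `|t - u|)).
  apply: ler_pM => //; [by rewrite mulr_ge0 ?powR_ge0// (le_trans ler01 p1)|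
    by rewrite lerDl|exact: ler_dist_dist].
by rewrite mulrC -ltr_pdivlMr.
Unshelve. all: by end_near. Qed.

Lemma cvg_of_powR (T : Type) (F : set_system T) (f : T -> R) (l : R) : Filter F ->
  (forall t, 0 <= f t) -> 0 <= l ->
  f t `^ p @[t --> F] --> l `^ p -> f t @[t --> F] --> l.
Proof.
move=> FF f0 l0 fl; apply/cvgrPdist_lt => e e0.
have h1 : \forall t \near F, f t < l + e.
  have : l `^ p < (l + e) `^ p.
    by apply: gt0_ltr_powR; rewrite ?nnegrE ?addr_ge0 ?(ltW e0)// ltrDl.
  move=> /(cvgr_lt _ fl); apply: filterS => t; apply: contraTT.
  by rewrite -!leNgt; apply: ler_powRp => //; rewrite addr_ge0 ?(ltW e0).
have h2 : \forall t \near F, l - e < f t.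
  have [le|le] := ltP (l - e) 0; first by apply: filterE => t; exact: lt_le_trans le _.
  have : (l - e) `^ p < l `^ p.
    by apply: gt0_ltr_powR; rewrite ?nnegrE// ltrBlDr ltrDl.
  move=> /(cvgr_gt _ fl); apply: filterS => t; apply: contraTT.
  by rewrite -!leNgt; apply: ler_powRp.
by apply: filterS2 h1 h2 => t t1 t2; rewrite ltr_norml; lra.
Qed.

End powR_inequalities.

Section FBL_norm.
Context {R : realType} (p : R) (E : normedModType R).
Hypothesis p1 : 1 <= p.
Implicit Types f g : dual E -> R.

Let p0 : 0 < p. Proof. exact: lt_le_trans ltr01 p1. Qed.

Lemma dual_sumE (V : normedModType R) n (x : 'I_n -> dual V) (v : V) :
  (\sum_(j < n) x j : dual V) v = \sum_(j < n) x j v.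
Proof. by rewrite -[LHS]/(bidual_embedding v _) linear_sum. Qed.

Lemma weak_pnorm_le1 n (x : 'I_n -> dual E) : (weak_pnorm p x <= 1)%E <->
  forall v, `|v| <= 1 -> \sum_(j < n) `|x j v| `^ p <= 1.
Proof.
have E1 s : 0 <= s -> ((s `^ p^-1)%:E <= 1)%E = (s <= 1).
  by move=> s0; rewrite lee_fin powRV_le// powR1.
split=> [h v v1|h].
  rewrite -E1 ?sum_powR_ge0//; apply: le_trans h; apply: ereal_sup_ubound.
  by exists v.
by apply: ub_ereal_sup => _ [v v1 <-]; rewrite E1 ?sum_powR_ge0// h.
Qed.

Lemma FBL_norm_leP f (C : R) : 0 <= C -> (FBL_norm p f <= C%:E)%E <->
  forall n (x : 'I_n -> dual E), (weak_pnorm p x <= 1)%E ->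
    \sum_(j < n) `|f (x j)| `^ p <= C `^ p.
Proof.
move=> C0; split=> [h n x x1|h].
  rewrite -(powRV_le p1) ?sum_powR_ge0// -lee_fin; apply: le_trans h.
  by apply: ereal_sup_ubound; exists n, x.
apply: ub_ereal_sup => _ [n [x [x1 ->]]].
by rewrite lee_fin (powRV_le p1) ?sum_powR_ge0// h.
Qed.

Lemma HpP f : Hp p E f <-> pos_homogeneous E f /\
  exists2 C : R, 0 <= C & forall n (x : 'I_n -> dual E),
    (weak_pnorm p x <= 1)%E -> \sum_(j < n) `|f (x j)| `^ p <= C.
Proof.
split=> [[hf fy]|[hf [C C0 fC]]]; split=> //.
  have [C C0 fC] : exists2 C : R, 0 <= C & (FBL_norm p f <= C%:E)%E.
    case: (FBL_norm p f) fy => [r _| |] //; last by exists 0; rewrite ?leNye.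
    by exists (Num.max 0 r); rewrite ?le_max ?lexx// lee_fin le_max lexx orbT.
  exists (C `^ p); first exact: powR_ge0.
  exact/FBL_norm_leP.
apply: (@le_lt_trans _ _ (C `^ p^-1)%:E); last exact: ltry.
by apply/FBL_norm_leP => [|n x x1]; rewrite ?powR_ge0// powRVK// fC.
Qed.

Lemma weak_pnorm1_le1 (x : dual E) : `|x| <= 1 ->
  (weak_pnorm p (fun _ : 'I_1 => x) <= 1)%E.
Proof.
move=> x1; apply/weak_pnorm_le1 => v v1; rewrite big_ord1.
rewrite -[leRHS](powR1r p); apply: ler_powRp => //.
exact: dual_le1.
Qed.

Lemma FBL_norm_ball f (C : R) (x : dual E) : 0 <= C -> (FBL_norm p f <= C%:E)%E ->
  `|x| <= 1 -> `|f x| <= C.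
Proof.
move=> C0 /(FBL_norm_leP _ C0) h /weak_pnorm1_le1/h; rewrite big_ord1.
by rewrite -(powRV_le p1) ?powR_ge0// powRKV.
Qed.

(** The weak [p]-norm of a tuple of functionals does not increase when the unit ball
    is replaced by the bidual ball.  With [S = \sum_j |z x_j|^p], the functional
    [phi = \sum_j sg (z x_j) |z x_j|^(p-1) x_j] satisfies [z phi = S], while
    Young's inequality bounds its norm by [(1 + (p - 1) S) / p]; hence [S <= 1]. *)
Lemma weak_pnorm_bidual n (x : 'I_n -> dual E) (z : dual (dual E)) :
  (weak_pnorm p x <= 1)%E -> `|z| <= 1 -> \sum_(j < n) `|z (x j)| `^ p <= 1.
Proof.
move=> /weak_pnorm_le1 x1 z1; set S := \sum_(j < n) _.
pose a j := `|z (x j)| `^ (p - 1).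
pose phi : dual E := \sum_(j < n) (Num.sg (z (x j)) * a j) *: x j.
have zphi : z phi = S.
  rewrite linear_sum; apply: eq_bigr => j _.
  rewrite linearZ /= [LHS]mulrAC -normrEsg.
  exact: mulr_powRB1.
have phiS : `|phi| <= (1 + (p - 1) * S) / p.
  apply: dual_norm_le => v v1.
  rewrite dual_sumE ler_pdivlMr// mulrC.
  apply: (@le_trans _ _ (\sum_(j < n) p * (`|x j v| * a j))).
    rewrite -mulr_sumr ler_wpM2l ?(ltW p0)//.
    apply: (le_trans (ler_norm_sum _ _ _)); apply: ler_sum => j _.
    rewrite [X in `|X|](_ : _ = (Num.sg (z (x j)) * a j) * x j v)//.
    rewrite normrM mulrC ler_wpM2l// normrM (ger0_norm (powR_ge0 _ _)).
    by rewrite ler_piMl ?powR_ge0// normr_sg; case: (_ == 0).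
  apply: (@le_trans _ _ (\sum_(j < n) (`|x j v| `^ p + (p - 1) * `|z (x j)| `^ p))).
    by apply: ler_sum => j _; exact: young_powR.
  by rewrite big_split /= -mulr_sumr lerD2r x1.
have : S <= (1 + (p - 1) * S) / p.
  rewrite -[leLHS]zphi (le_trans (ler_norm _))// (le_trans (dual_normP _ _))//.
  by rewrite (le_trans _ phiS)// -[leRHS]mul1r ler_wpM2r.
rewrite ler_pdivlMr//; lra.
Qed.

End FBL_norm.

(** * The order ideals of positively homogeneous functions *)

Section order_ideals_of_Hp.
Context {R : realType} (p : R) (E : normedModType R).
Hypothesis p1 : 1 <= p.
Implicit Types f g : dual E -> R.

Lemma pos_homogeneous0 f : pos_homogeneous E f -> f 0 = 0.
Proof. by move=> hf; rewrite -(scale0r 0) hf// mul0r. Qed.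

Lemma Hp_order_ideal : order_ideal (Hp p E) (Hp p E).
Proof.
split; first by move=> f.
- apply/(HpP p1); split; first by move=> l x _; rewrite mulr0.
  exists 0 => // n x _; rewrite big1// => j _.
  by rewrite normr0 powR0// gt_eqF// (lt_le_trans ltr01 p1).
- move=> f g /(HpP p1)[] hf [C C0 fC] /(HpP p1)[] hg [D D0 gD]; apply/(HpP p1); split.
    by move=> l x l0 /=; rewrite hf// hg// mulrDr.
  exists (2 `^ p * (C + D)); first by rewrite mulr_ge0 ?powR_ge0 ?addr_ge0.
  move=> n x x1; apply: (@le_trans _ _ (\sum_(j < n)
      2 `^ p * (`|f (x j)| `^ p + `|g (x j)| `^ p))).
    by apply: ler_sum => j _; exact: powR_add_le.
  by rewrite -mulr_sumr big_split /= ler_wpM2l ?powR_ge0// lerD ?fC ?gD.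
- move=> a f /(HpP p1)[] hf [C C0 fC]; apply/(HpP p1); split.
    by move=> l x l0 /=; rewrite hf// mulrCA.
  exists (`|a| `^ p * C); first by rewrite mulr_ge0 ?powR_ge0.
  move=> n x x1; under eq_bigr do rewrite normrM powRM//.
  by rewrite -mulr_sumr ler_wpM2l ?powR_ge0// fC.
- by move=> f g.
Qed.

Lemma Jpw_sub_Hp : Jpw p E `<=` Hp p E.
Proof. by apply: smallest_sub; [exact: Hp_order_ideal|move=> f []]. Qed.

(** A positively homogeneous function vanishes at 0, so that continuity there is
    smallness nearby. *)
Lemma cvg_at0P f : pos_homogeneous E f ->
  {for dual_ball0 E, continuous (f \o @dual_ball_val R E)} <->
  forall e, 0 < e -> \forall u \near dual_ball0 E, `|f (dual_ball_val u)| < e.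
Proof.
move=> hf; have f0 : f (dual_ball_val (dual_ball0 E)) = 0.
  exact: pos_homogeneous0.
split=> [cf|h].
  have : f (dual_ball_val u) @[u --> dual_ball0 E] --> f (dual_ball_val (dual_ball0 E)).
    exact: cf.
  by rewrite f0 => /cvgr0Pnorm_lt.
suff : f (dual_ball_val u) @[u --> dual_ball0 E] --> f (dual_ball_val (dual_ball0 E)).
  by [].
rewrite f0; apply/(@cvgr0Pnorm_lt _ _ _ (nbhs (dual_ball0 E)) (nbhs_filter _)).
by move=> e e0; exact: h.
Qed.

Lemma Mpw0_order_ideal : order_ideal (Hp p E) (Mpw0 p E).
Proof.
have [_ H0 HD HZ _] := Hp_order_ideal; split.
- by move=> f [].
- by split=> //; apply: cst_continuous.
- move=> f g [Hf cf] [Hg cg]; split; [exact: HD|exact: (continuousD cf cg)].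
- move=> a f [Hf cf]; split; first exact: HZ.
  exact: (continuous_comp cf (@mulrl_continuous _ a _)).
- move=> f g Hf [Hg /(cvg_at0P Hg.1) cg] fg; split=> //.
  apply/cvg_at0P; first exact: Hf.1.
  move=> e e0; near=> u; rewrite (le_lt_trans (fg _))//.
  by near: u; exact: cg.
Unshelve. all: by end_near. Qed.

Lemma Jpw_sub_Mpw0 : Jpw p E `<=` Mpw0 p E.
Proof.
apply: smallest_sub; first exact: Mpw0_order_ideal.
by move=> f [Hf [_ cf]]; split=> //; exact: cf.
Qed.

Lemma Mpw0_closed : FBL_closure p (Mpw0 p E) `<=` Mpw0 p E.
Proof.
move=> f [Hf fcl]; split=> //; apply/cvg_at0P; first exact: Hf.1.
move=> e e0; have e20 : 0 < e / 2 by rewrite divr_gt0.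
have [g [Hg /(cvg_at0P Hg.1) cg] /ltW fg] := fcl _ e20.
near=> u; rewrite -(subrK (g (dual_ball_val u)) (f _)).
rewrite (le_lt_trans (ler_normD _ _))// [ltRHS]splitr ler_ltD//.
  exact: (FBL_norm_ball p1 (ltW e20) fg (dual_ball_val_le1 u)).
by near: u; exact: cg.
Unshelve. all: by end_near. Qed.

Lemma sub_FBL_closure (A : set (dual E -> R)) : A `<=` Hp p E ->
  A `<=` FBL_closure p A.
Proof.
move=> AH f Af; split; first exact: AH.
move=> e e0; exists f => //; apply: (@le_lt_trans _ _ 0%:E); last by rewrite lte_fin.
apply/FBL_norm_leP => // n x _; rewrite big1 ?powR_ge0// => j _.
by rewrite /= subrr normr0 powR0// gt_eqF// (lt_le_trans ltr01 p1).
Qed.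

End order_ideals_of_Hp.

(** * Positive functionals on continuous functions *)

Section positive_functionals.
Context {R : realType} {T : topologicalType}.
Implicit Types (L : (T -> R) -> R) (f g : T -> R).

(** Positive linear functionals on the space of continuous functions, as functions
    of arbitrary arguments whose values at discontinuous ones are irrelevant. *)
Definition positive_functional L : Prop :=
  [/\ forall f g, continuous f -> continuous g ->
        L (fun t => f t + g t) = L f + L g,
      forall (a : R) f, continuous f -> L (fun t => a * f t) = a * L f &
      forall f, continuous f -> (forall t, 0 <= f t) -> 0 <= L f].

Lemma continuous_scale (a : R) f : continuous f -> continuous (fun t => a * f t).
Proof. by move=> cf t; exact: (continuous_comp (cf t) (@mulrl_continuous _ a _)). Qed.

Lemma continuous_add f g : continuous f -> continuous g ->
  continuous (fun t => f t + g t).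
Proof. by move=> cf cg t; exact: (cvgD (cf t) (cg t)). Qed.

Lemma continuous_sum n (F : 'I_n -> T -> R) : (forall j, continuous (F j)) ->
  continuous (fun t => \sum_(j < n) F j t).
Proof.
move=> cF; elim: n F cF => [|n IH] F cF.
  by under eq_fun do rewrite big_ord0; exact: cst_continuous.
under eq_fun do rewrite big_ord_recr /=.
by apply: continuous_add => //; exact: IH.
Qed.

Section theory.
Variable L : (T -> R) -> R.
Hypothesis Lpos : positive_functional L.

Lemma positive_functionalB f g : continuous f -> continuous g ->
  L (fun t => f t - g t) = L f - L g.
Proof.
move=> cf cg; have [LD LZ _] := Lpos.
have cNg := @continuous_scale (-1) _ cg.
rewrite -[RHS]addr0 -mulN1r -LZ// addr0 -LD//.
by congr (L _); apply/funext => t; rewrite mulN1r.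
Qed.

Lemma positive_functional_le f g : continuous f -> continuous g ->
  (forall t, f t <= g t) -> L f <= L g.
Proof.
move=> cf cg fg; rewrite -subr_ge0 -positive_functionalB//.
have [_ _ L0] := Lpos; apply: L0 => [|t]; last by rewrite subr_ge0.
by move=> t; exact: (cvgB (cg t) (cf t)).
Qed.

Lemma positive_functional_sum n (F : 'I_n -> T -> R) :
  (forall j, continuous (F j)) ->
  L (fun t => \sum_(j < n) F j t) = \sum_(j < n) L (F j).
Proof.
have [LD LZ _] := Lpos; move=> cF; elim: n F cF => [|n IH] F cF.
  rewrite big_ord0 -[RHS](mul0r (L (cst 0))) -LZ; last exact: cst_continuous.
  by congr (L _); apply/funext => t; rewrite big_ord0 mul0r.
rewrite big_ord_recr /= -IH// -LD//; last by apply: continuous_sum.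
by congr (L _); apply/funext => t; rewrite big_ord_recr.
Qed.

Lemma positive_functional_cst (a : R) : L (fun=> a) = a * L (fun=> 1).
Proof.
have [_ LZ _] := Lpos; rewrite -LZ; last exact: cst_continuous.
by congr (L _); apply/funext => t; rewrite mulr1.
Qed.

Lemma positive_functional1_ge0 : 0 <= L (fun=> 1).
Proof. by have [_ _ L0] := Lpos; apply: L0 => // t; exact: cst_continuous. Qed.

End theory.

Hypothesis Tcompact : compact [set: T].

Lemma compact_continuous_bounded g : continuous g ->
  exists2 M : R, 0 <= M & forall t, `|g t| <= M.
Proof.
move=> cg; have /compact_bounded/pinfty_ex_gt0[M M0 gM] :
    compact (g @` [set: T] : set R^o).
  by apply: continuous_compact => //; exact: continuous_subspaceT.
by exists M => [|t]; [exact: ltW|apply: gM; exists t].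
Qed.

Lemma dini (d : nat -> T -> R) : (forall n, continuous (d n)) ->
  (forall m n t, (m <= n)%N -> d n t <= d m t) ->
  (forall t e, 0 < e -> exists n, d n t < e) ->
  forall e, 0 < e -> exists n, forall t, d n t < e.
Proof.
move=> cd dd d0 e e0; apply: contrapT => /forallNP dN.
have /choice[t_ dt] : forall n, exists t, e <= d n t.
  by move=> n; have /existsNP[t /negP] := dN n; rewrite -leNgt; exists t.
have [|p [_ Fp]] := @Tcompact (t_ n @[n --> \oo]) _; first exact: filterT.
have [n dnp] := d0 p e e0.
have F1 : (t_ n @[n --> \oo]) [set t | e <= d n t].
  by exists n => // m /= nm; rewrite (le_trans (dt m))// dd.
have F2 : nbhs p [set t | d n t < e] by exact: (cvgr_lt _ (cd n p)).
have [t [/= h1 h2]] := Fp _ _ F1 F2.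
by move: h2; rewrite ltNge h1.
Qed.

(** Bounded convergence for positive functionals, without representing them by
    measures.  Let [U n] be the set of continuous functions between 0 and
    [sup_(m >= n) g m], and [a n] the supremum of [L] on it.  If [c n] in [U n]
    nearly attains [a n], the lattice identity shows that the minimum [d n] of
    [c 0], ..., [c n] still nearly attains [a n]; by Dini [d n] tends to 0
    uniformly, so [a n], which bounds [L (g n)], tends to 0. *)
Theorem positive_functional_cvg0 L (g : nat -> T -> R) (M : R) :
  positive_functional L -> (forall n, continuous (g n)) ->
  (forall n t, 0 <= g n t <= M) ->
  (forall t, g n t @[n --> \oo] --> (0 : R)) ->
  L (g n) @[n --> \oo] --> (0 : R).
Proof.
move=> Lpos cg gM g0; have [LD LZ L0] := Lpos.
pose U n := [set c : T -> R | [/\ continuous c, forall t, 0 <= c t &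
  forall t, exists2 m, (n <= m)%N & c t <= g m t]].
pose a n := sup [set L c | c in U n].
have gU n : U n (g n) by split=> // t; [have /andP[] := gM n t|exists n].
have hs n : has_sup [set L c | c in U n].
  split; first by exists (L (g n)), (g n).
  exists (L (fun=> M)) => _ [c [cc c0 cg'] <-].
  apply: positive_functional_le => //; first exact: cst_continuous.
  by move=> t; have [m _ /le_trans] := cg' t; apply; have /andP[] := gM m t.
have aub n c : U n c -> L c <= a n.
  by move=> Uc; apply: (sup_upper_bound (hs n)); exists c.
apply/cvgr0Pnorm_lt => e e0.
(* the total error allowed up to step [n]: the sum of [e / 2 * 2^-k] for [1 <= k <= n] *)
pose ep n := e / 2 * (1 - 2^-1 ^+ n).
have epS n : ep n.+1 = ep n + e / 2 * 2^-1 ^+ n.+1.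
  by rewrite /ep exprS; lra.
have /choice[c cP] : forall n, exists c, U n c /\ a n - e / 2 * 2^-1 ^+ n.+1 < L c.
  move=> n; have [|_ [c Uc <-] h] := @sup_adherent _ _ (e / 2 * 2^-1 ^+ n.+1) _ (hs n).
    by rewrite mulr_gt0 ?divr_gt0// exprn_gt0// invr_gt0.
  by exists c.
pose d := fix d n : T -> R := if n is m.+1 then (fun t => Num.min (d m t) (c n t)) else c 0.
have dU n : U n (d n).
  case: n => [|n] /=; first by have [] := cP 0%N.
  have [[cc c0 cg'] _] := cP n.+1.
  have [cd d0] : continuous (d n) /\ forall t, 0 <= d n t.
    elim: n {cc c0 cg'} => [|n [IH1 IH2]] /=.
      by have [[]] := cP 0%N.
    have [[cc c0 cg'] _] := cP n.+1; split.
      exact: (min_fun_continuous IH1 cc).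
    by move=> t; rewrite le_min IH2 c0.
  split; first exact: (min_fun_continuous cd cc).
    by move=> t; rewrite le_min d0 c0.
  by move=> t; have [m nm ct] := cg' t; exists m => //; rewrite ge_min ct orbT.
have dL n : a n - ep n.+1 <= L (d n).
  elim: n => [|n IH].
    by have [_ /ltW] := cP 0%N; rewrite epS {1}/ep expr0 subrr mulr0 add0r.
  have [cd d0 dg] := dU n; have [[cc c0 cg'] cL] := cP n.+1.
  (* the lattice identity [min d c + max d c = d + c] *)
  have cmin := min_fun_continuous cd cc; have cmax := max_fun_continuous cd cc.
  have : L (fun t => Num.min (d n t) (c n.+1 t)) +
         L (fun t => Num.max (d n t) (c n.+1 t)) = L (d n) + L (c n.+1).
    by rewrite -LD// -LD//; congr (L _); apply/funext => t; exact: addr_min_max.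
  have : L (fun t => Num.max (d n t) (c n.+1 t)) <= a n.
    apply: aub; split=> // t; first by rewrite le_max d0.
    have [dc|cd'] := leP (d n t) (c n.+1 t).
      by have [m nm ct] := cg' t; exists m => //; rewrite ltnW.
    by have [m nm ct] := dg t; exists m.
  rewrite [L (d n.+1)]/=; rewrite epS; lra.
have [N dN] : exists N, forall t, d N t < e / (2 * (L (fun=> 1) + 1)).
  apply: dini.
  - by move=> n; have [] := dU n.
  - move=> m n t /subnK <-; elim: (n - m)%N => //= k IH.
    by rewrite ge_min IH.
  - move=> t r r0; have /cvgr0Pnorm_lt/(_ r r0)[n _ gn] := g0 t.
    have [_ _ /(_ t)[m nm dm]] := dU n; exists n.
    by rewrite (le_lt_trans dm)// (le_lt_trans (ler_norm _))// gn.
  - have l0 := positive_functional1_ge0 Lpos.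
    by rewrite divr_gt0// mulr_gt0// ltr_pwDr.
have l0 := positive_functional1_ge0 Lpos.
have LdN : L (d N) <= e / 2 * (L (fun=> 1) / (L (fun=> 1) + 1)).
  apply: (@le_trans _ _ (L (fun=> e / (2 * (L (fun=> 1) + 1))))).
    apply: positive_functional_le => //; [by have [] := dU N|exact: cst_continuous|].
    by move=> t; exact/ltW/dN.
  rewrite positive_functional_cst//; apply/eqP/eqP.
  rewrite le_eqVlt; apply/orP; left; apply/eqP; field.
  by rewrite gt_eqF// ltr_pwDr.
have LdN' : L (d N) < e / 2.
  rewrite (le_lt_trans LdN)// gtr_pMr ?divr_gt0//.
  by rewrite ltr_pdivrMr ?mul1r ?ltrDl// ltr_pwDr.
have epN : ep N.+1 < e / 2.
  rewrite /ep gtr_pMr ?divr_gt0// gtrBl exprn_gt0// invr_gt0//.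
exists N => // n /= Nn.
rewrite ger0_norm; last by apply: L0 => // t; have /andP[] := gM n t.
have : L (g n) <= a N.
  apply: aub; split=> // t; first by have /andP[] := gM n t.
  by exists n.
have := dL N; lra.
Qed.

End positive_functionals.

(** * Weak* null sequences in the dual of a reflexive space *)

Section rational_combinations.
Context {R : realType} {V : normedModType R}.

(** The linear combination of the terms of [x] with a list of coefficients and indices. *)
Definition comb (x : nat -> V) (c : seq (R * nat)) : V :=
  \sum_(q <- c) q.1 *: x q.2.

(** Combinations with rational coefficients: there are countably many of them. *)
Definition rat_comb (x : nat -> V) (c : seq (rat * nat)) : V :=
  comb x [seq (ratr q.1, q.2) | q <- c].

Lemma rat_comb_dense (x : nat -> V) (c : seq (R * nat)) (e : R) :
  0 < e -> exists c', `|comb x c - rat_comb x c'| < e.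
Proof.
elim: c e => [|[a i] c IH] e e0.
  by exists [::]; rewrite /rat_comb/= subrr normr0.
have e20 : 0 < e / 2 by rewrite divr_gt0.
have [c' cc'] := IH _ e20.
have xi : 0 < `|x i| + 1 by rewrite ltr_wpDl.
have d0 : 0 < e / 2 / (`|x i| + 1) by rewrite divr_gt0.
have /rat_in_itvoo[q] : a - e / 2 / (`|x i| + 1) < a + e / 2 / (`|x i| + 1) by lra.
rewrite in_itv /= => /andP[q1 q2]; exists ((q, i) :: c').
rewrite /rat_comb /comb /= !big_cons /= opprD addrACA -scalerBl.
rewrite (le_lt_trans (ler_normD _ _))// [ltRHS]splitr ler_ltD// normrZ.
apply: (@le_trans _ _ (e / 2 / (`|x i| + 1) * (`|x i| + 1))).
  by apply: ler_pM => //; [rewrite ler_norml; lra|rewrite lerDl].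
by rewrite divfK// gt_eqF.
Qed.

Lemma comb_subspace (x : nat -> V) : subspace_set (range (comb x)).
Proof.
split.
- by exists [::] => //; rewrite /comb big_nil.
- by move=> _ _ [c _ <-] [c' _ <-]; exists (c ++ c') => //; rewrite /comb big_cat.
- move=> a _ [c _ <-]; exists [seq (a * q.1, q.2) | q <- c] => //.
  by rewrite /comb big_map scaler_sumr; apply: eq_bigr => q _; rewrite scalerA.
Qed.

Lemma eq_rat_comb (x y : nat -> V) (c : seq (rat * nat)) :
  (forall q, q \in c -> x q.2 = y q.2) -> rat_comb x c = rat_comb y c.
Proof.
move=> xy; rewrite /rat_comb /comb !big_map big_seq [RHS]big_seq.
by apply: eq_bigr => q /xy ->.
Qed.

End rational_combinations.

Section reflexive.
Context {R : realType} {E : normedModType R}.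

Lemma almost_norming (f : dual E) : exists2 v, `|v| <= 1 & `|f| <= 2 * `|f v|.
Proof.
have [->|f0] := eqVneq f 0.
  by exists 0; rewrite ?normr0// mulr_ge0.
have nf0 : 0 < `|f| by rewrite normr_gt0.
have [|_ [v v1 <-] h] := @sup_adherent _ _ (`|f| / 2) _ (dual_has_sup f).
  by rewrite divr_gt0.
exists v => //; move: h; rewrite -[sup _]/(`|f|); lra.
Qed.

(** In the dual ball of a reflexive space, a set having 0 as a weak* limit point
    contains a weak* null sequence (Kaplansky, with the argument of Whitley).  The
    sequence is chosen so that its terms become small on an almost norming vector
    of every rational combination of its terms.  A weak* cluster point [y]
    then vanishes on all these vectors; by reflexivity [y] is a norm limit of the
    combinations, hence is 0. *)
Lemma weakstar_null_sequence (A : set (dual_ball E)) : reflexive_space E ->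
  (forall (s : seq E) (e : R), 0 < e ->
     exists2 u, A u & forall v, v \in s -> `|dual_ball_val u v| < e) ->
  exists x : nat -> dual_ball E, (forall n, A (x n)) /\
    forall v, dual_ball_val (x n) v @[n --> \oo] --> (0 : R).
Proof.
move=> Erefl A0.
have /choice[nrm nrmP] : forall f : dual E, exists v,
    `|v| <= 1 /\ `|f| <= 2 * `|f v|.
  by move=> f; have [v] := almost_norming f; exists v.
(* the next term is [step l], where [l] lists the terms already chosen, and
   [pts l] lists the vectors on which it has to be small *)
pose nth_ (l : seq (dual_ball E)) i := dual_ball_val (nth (dual_ball0 E) l i).
pose pts (l : seq (dual_ball E)) := [seq nrm (rat_comb (nth_ l)
   (odflt [::] (unpickle k))) | k <- iota 0 (size l)].
have /choice[step stepP] : forall l, exists u, A u /\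
    forall v, v \in pts l -> `|dual_ball_val u v| < (size l).+1%:R^-1.
  by move=> l; have [|u Au uv] := A0 (pts l) (size l).+1%:R^-1; [|exists u].
pose l_ := fix l_ n := if n is m.+1 then rcons (l_ m) (step (l_ m)) else [::].
pose x n := step (l_ n).
have lE n : l_ n = mkseq x n.
  by elim: n => // n IH; rewrite mkseqS -IH.
pose xv n := dual_ball_val (x n).
have Ax n : A (x n) by have [] := stepP (l_ n).
have xnrm (c : seq (rat * nat)) : xv n (nrm (rat_comb xv c)) @[n --> \oo] --> (0 : R).
  (* beyond [N], the code of [c] has been met and its indices are in range *)
  pose N := (pickle c + \sum_(q <- c) q.2).+1.
  have cN q : q \in c -> (q.2 < N)%N.
    move=> qc; rewrite ltnS (leq_trans _ (leq_addl _ _))//.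
    by rewrite (big_rem q)//= leq_addr.
  have xN n : (N <= n)%N -> `|xv n (nrm (rat_comb xv c))| < n.+1%:R^-1.
    move=> Nn; have [_ h] := stepP (l_ n).
    rewrite lE size_mkseq -lE in h; apply: h.
    rewrite /pts lE; apply/mapP; exists (pickle c).
      by rewrite mem_iota size_mkseq/= add0n (leq_trans _ Nn)// ltnS leq_addr.
    rewrite pickleK /=; congr nrm; apply: eq_rat_comb => q qc.
    by rewrite /nth_ nth_mkseq// (leq_trans (cN _ qc)).
  apply/cvgr0Pnorm_lt => e e0; near=> n.
  rewrite (lt_trans (xN n _))//; first by near: n; exact: nbhs_infty_ge.
  by near: n; exact: near_infty_natSinv_lt (PosNum e0).
exists x; split=> // v; apply/cvgr0Pnorm_lt => e e0; apply: contrapT => nx.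
have /choice[phi phiP] : forall N, exists n, (N <= n)%N /\ e <= `|xv n v|.
  move=> N; apply: contrapT => /forallNP h; apply: nx; exists N => // n /= Nn.
  by rewrite ltNge; apply/negP => ex; apply: (h n).
pose F := (x (phi n) @[n --> \oo]).
have FF : ProperFilter F by exact: fmap_proper_filter.
have [|y [_]] := @banach_alaoglu R E F FF; first exact: filterT.
rewrite cluster_cvgE => -[G GG [/dual_ballP Gy FG]].
have yv : e <= `|dual_ball_val y v|.
  apply: (closed_cvg (fun r : R => e <= `|r|) _ _ _ (Gy v)).
    apply: (@closed_comp _ _ (@Num.norm _ R) [set r | e <= r]).
      by move=> r _; exact: norm_continuous.
    exact: closed_ge.
  by apply: FG; exists 0%N => // n _ /=; have [] := phiP n.
have y0 w : xv n w @[n --> \oo] --> (0 : R) -> dual_ball_val y w = 0.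
  move=> xw; apply: (cvg_unique (@Rhausdorff R) (Gy w)).
  move=> B /xw[N _ NB]; apply: FG; exists N => // n /= Nn.
  by apply: NB => /=; have [Nphi _] := phiP n; exact: leq_trans Nphi.
have y_approx (d : R) : 0 < d ->
    exists c, `|dual_ball_val y - rat_comb xv c| < d.
  move=> d0; have d20 : 0 < d / 2 by rewrite divr_gt0.
  suff [c yc] : exists c, `|dual_ball_val y - comb xv c| < d / 2.
    have [c' cc'] := rat_comb_dense xv c d20; exists c'.
    rewrite -(subrK (comb xv c) (dual_ball_val y)) -addrA.
    by rewrite (le_lt_trans (ler_normD _ _))// [ltRHS]splitr ltrD.
  apply: contrapT => /forallNP nc.
  have [|f [fS]] := dual_separation (comb_subspace xv) d20 (y := dual_ball_val y).
    by move=> _ [c _ <-]; rewrite leNgt; apply/negP; exact: nc.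
  have [w _ fw] : range (@bidual_embedding R E) f by rewrite Erefl.
  rewrite -fw /= /eval_at y0 ?eqxx//.
  suff -> : (fun n => xv n w) = cst 0 by exact: cvg_cst.
  apply/funext => n; rewrite -[LHS]/(bidual_embedding w (xv n)) fw fS//.
  by exists [:: (1, n)] => //; rewrite /comb big_seq1 scale1r.
suff yy0 : `|dual_ball_val y| = 0.
  move/normr0_eq0 : yy0 => yy0; move: yv; rewrite yy0 normr0.
  by rewrite leNgt e0.
apply: contrapT => /eqP yn0; have ny0 : 0 < `|dual_ball_val y|.
  by rewrite lt_neqAle eq_sym yn0 normr_ge0.
have [|c yc] := y_approx (`|dual_ball_val y| / 6); first by rewrite divr_gt0.
set g := rat_comb xv c in yc.
have [n1 ng] := nrmP g.
have yg0 : dual_ball_val y (nrm g) = 0 by apply: y0; exact: xnrm.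
have : `|g (nrm g)| <= `|dual_ball_val y - g|.
  rewrite -normrN; have := dual_norm_ub (dual_ball_val y - g) n1.
  by rewrite (_ : (_ - g) _ = dual_ball_val y (nrm g) - g (nrm g))// yg0 sub0r.
have : `|dual_ball_val y| <= `|dual_ball_val y - g| + `|g|.
  by rewrite -[in leLHS](subrK g (dual_ball_val y)) ler_normD.
lra.
Unshelve. all: by end_near. Qed.

End reflexive.

(** * The function of a positive functional *)

Section functional_pnorm.
Context {R : realType} (p : R) {E : normedModType R}.
Hypothesis p1 : 1 <= p.
Local Notation K := (dual_ball (dual E)).
Implicit Type L : (K -> R) -> R.

Let p0 : 0 < p. Proof. exact: lt_le_trans ltr01 p1. Qed.

(** The function [f_mu^p], for a positive functional [L] in place of the integral
    against [mu]. *)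
Definition functional_pnorm L (x : dual E) : R :=
  L (fun z => `|dual_ball_val z x| `^ p) `^ p^-1.

Lemma continuous_eval_norm (x : dual E) :
  continuous (fun z : K => `|dual_ball_val z x|).
Proof.
move=> z; have cz := @dual_ball_eval_continuous R (dual E) x z.
exact: (continuous_comp cz (@norm_continuous _ R _)).
Qed.

Lemma continuous_eval_powR (x : dual E) :
  continuous (fun z : K => `|dual_ball_val z x| `^ p).
Proof.
move=> z; have cz := @dual_ball_eval_continuous R (dual E) x z.
exact: (continuous_comp cz (@continuous_norm_powR R p p1 _)).
Qed.

Variable L : (K -> R) -> R.
Hypothesis Lpos : positive_functional L.

Lemma functional_powR_ge0 (x : dual E) :
  0 <= L (fun z => `|dual_ball_val z x| `^ p).
Proof.
have [_ _ L0] := Lpos; apply: L0; first exact: continuous_eval_powR.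
by move=> z; exact: powR_ge0.
Qed.

Lemma functional_pnormK (x : dual E) :
  functional_pnorm L x `^ p = L (fun z => `|dual_ball_val z x| `^ p).
Proof. by rewrite powRVK// functional_powR_ge0. Qed.

Lemma functional_pnorm_Hp : Hp p E (functional_pnorm L).
Proof.
have [LD LZ L0] := Lpos.
apply/(HpP p1); split.
  move=> l x l0; rewrite /functional_pnorm.
  rewrite (_ : (fun z : K => _) = fun z => l `^ p * `|dual_ball_val z x| `^ p).
    rewrite LZ; last exact: continuous_eval_powR.
    by rewrite powRM ?powR_ge0 ?functional_powR_ge0// powRKV.
  apply/funext => z; rewrite -powRM//; congr (_ `^ p).
  by rewrite linearZ normrM (ger0_norm l0).
exists (L (fun=> 1)); first exact: positive_functional1_ge0.
move=> n x x1; under eq_bigr => j _.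
  rewrite ger0_norm ?powR_ge0// functional_pnormK; over.
rewrite -(positive_functional_sum Lpos (F := fun j z => `|dual_ball_val z (x j)| `^ p)).
  apply: (positive_functional_le Lpos); last 1 first.
  - by move=> z; apply: (weak_pnorm_bidual p1 x1); exact: dual_ball_val_le1.
  - by apply: continuous_sum => j; exact: continuous_eval_powR.
  - exact: cst_continuous.
by move=> j; exact: continuous_eval_powR.
Qed.

Hypothesis Erefl : reflexive_space E.

(** The seminorm [x |-> L (z |-> |z x|)] is weak* continuous at 0 on the dual ball:
    otherwise it would be bounded below along a weak* null sequence, which is
    pointwise null on the bidual ball by reflexivity. *)
Lemma functional_norm_cvg0 (e : R) : 0 < e ->
  \forall u \near dual_ball0 E, L (fun z => `|dual_ball_val z (dual_ball_val u)|) < e.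
Proof.
move=> e0; apply: contrapT => nL.
pose A := [set u : dual_ball E |
  e <= L (fun z => `|dual_ball_val z (dual_ball_val u)|)].
have [|x [Ax x0]] := @weakstar_null_sequence _ _ A Erefl.
  move=> s d d0; apply: contrapT => h; apply: nL.
  have : \forall u \near dual_ball0 E, forall v, v \in s -> `|dual_ball_val u v| < d.
    elim: s {h} => [|v s IH]; first by apply: filterE => u v; rewrite in_nil.
    have : \forall u \near dual_ball0 E, `|dual_ball_val u v| < d.
      have := @dual_ball_eval_continuous R E v (dual_ball0 E).
      by move=> /cvgr0_norm_lt; apply.
    apply: filterS2 IH => u us uv w; rewrite inE => /orP[/eqP ->//|]; exact: us.
  apply: filterS => u us; rewrite ltNge; apply/negP => Au; apply: h.
  by exists u.
pose g n := fun z : K => `|dual_ball_val z (dual_ball_val (x n))|.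
have /cvgr0Pnorm_lt/(_ _ e0) : L (g n) @[n --> \oo] --> (0 : R).
  apply: (@positive_functional_cvg0 R K (@banach_alaoglu R (dual E)) L g 1 Lpos).
  - by move=> n; exact: continuous_eval_norm.
  - by move=> n z; rewrite normr_ge0 dual_le1 ?dual_ball_val_le1.
  - move=> z; have [w _ wz] : range (@bidual_embedding R E) (dual_ball_val z).
      by rewrite Erefl.
    apply/cvgr0Pnorm_lt => d d0; have /cvgr0Pnorm_lt/(_ _ d0) := x0 w.
    by apply: filterS => n; rewrite /g -wz normr_id.
move=> [N _ /(_ N (leqnn N))/=].
by rewrite ltNge (le_trans (Ax N))// ler_norm.
Qed.

Lemma functional_pnorm_Hw : Hw E (functional_pnorm L).
Proof.
have [hL _] := functional_pnorm_Hp; split=> // u0.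
have [LD LZ L0] := Lpos.
have FF : Filter (nbhs u0) := nbhs_filter u0.
apply: (@cvg_of_powR R p p1 _ _ _ _ FF).
- by move=> u; exact: powR_ge0.
- exact: powR_ge0.
apply/(@cvgrPdist_lt _ _ _ _ FF) => e e0.
have C0 : 0 < p * 1 `^ (p - 1) * 2 by rewrite powR1r mulr1 mulr_gt0.
(* half the difference of two points of the ball lies in the ball *)
pose D (u : dual_ball E) : dual E := 2^-1 *: (dual_ball_val u0 - dual_ball_val u).
have D1 u : `|D u| <= 1.
  rewrite normrZ ger0_norm ?invr_ge0// ler_pdivrMl// mulr1.
  rewrite (le_trans (ler_normB _ _))//.
  by have := dual_ball_val_le1 u; have := dual_ball_val_le1 u0; lra.
pose d u := to_dual_ball (D1 u).
have dcvg : d u @[u --> u0] --> dual_ball0 E.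
  apply/dual_ballP => v.
  have -> : dual_ball_val (dual_ball0 E) v = 2^-1 * (dual_ball_val u0 v - dual_ball_val u0 v).
    by rewrite subrr mulr0.
  have := @dual_ball_eval_continuous R E v u0 => cv.
  have c1 := @cvgB _ _ _ _ FF _ _ _ _ (@cvg_cst _ _ _ _ FF) cv.
  exact: (cvg_comp _ _ (c1 _) (@mulrl_continuous R 2^-1 _)).
near=> u.
suff h : `|L (fun z => `|dual_ball_val z (dual_ball_val u0)| `^ p) -
    L (fun z => `|dual_ball_val z (dual_ball_val u)| `^ p)| < e.
  by rewrite -2!functional_pnormK in h; exact: h.
have cu (v : dual_ball E) := @continuous_eval_powR (dual_ball_val v).
have cd : continuous (fun z : K => p * 1 `^ (p - 1) * 2 * `|dual_ball_val z (D u)|).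
  by apply: continuous_scale; exact: continuous_eval_norm.
have lip (z : K) : `| `|dual_ball_val z (dual_ball_val u0)| `^ p -
    `|dual_ball_val z (dual_ball_val u)| `^ p | <=
    p * 1 `^ (p - 1) * 2 * `|dual_ball_val z (D u)|.
  have := @powR_lipschitz R p p1 1 `|dual_ball_val z (dual_ball_val u0)|
    `|dual_ball_val z (dual_ball_val u)|.
  rewrite !normr_ge0 !dual_le1 ?dual_ball_val_le1// => /(_ isT isT)/le_trans; apply.
  rewrite -[leRHS]mulrA ler_wpM2l//; first by rewrite mulr_ge0 ?powR_ge0 ?(ltW p0).
  rewrite linearZ linearB normrM ger0_norm ?invr_ge0// mulrA mulfV// mul1r.
  exact: ler_dist_dist.
apply: (@le_lt_trans _ _ (p * 1 `^ (p - 1) * 2 * L (fun z => `|dual_ball_val z (D u)|))).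
  rewrite -LZ; last exact: continuous_eval_norm.
  rewrite -(positive_functionalB Lpos (cu u0) (cu u)) ler_norml; apply/andP; split.
    rewrite -[leLHS]mulN1r -[leLHS](LZ _ _ cd).
    apply: (positive_functional_le Lpos).
    - exact: continuous_scale.
    - by move=> z; exact: (cvgB (cu u0 z) (cu u z)).
    - by move=> z; rewrite mulN1r; have := lip z; rewrite ler_norml => /andP[].
  apply: (positive_functional_le Lpos) => //.
    by move=> z; exact: (cvgB (cu u0 z) (cu u z)).
  by move=> z; have := lip z; rewrite ler_norml => /andP[].
rewrite mulrC -ltr_pdivlMr//.
near: u.
have eC : 0 < e / (p * 1 `^ (p - 1) * 2) by rewrite divr_gt0.
exact: (dcvg _ (functional_norm_cvg0 eC)).
Unshelve. all: by end_near. Qed.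

End functional_pnorm.

(** * Pietsch domination *)

Section pietsch.
Context {R : realType} (p : R) {E : normedModType R}.
Hypothesis p1 : 1 <= p.
Local Notation K := (dual_ball (dual E)).

Let p0 : 0 < p. Proof. exact: lt_le_trans ltr01 p1. Qed.

(** The inequality defining [Hp], for families of arbitrary weak norm. *)
Lemma Hp_weak_bound (f : dual E -> R) : Hp p E f ->
  exists2 C : R, 0 < C & forall (s : seq (dual E)) (S : R),
    (forall z : K, \sum_(y <- s) `|dual_ball_val z y| `^ p <= S) ->
    \sum_(y <- s) `|f y| `^ p <= C * S.
Proof.
move=> /(HpP p1)[hf [C C0 fC]]; exists (C + 1) => [|s S zS]; first by rewrite ltr_wpDl.
have C10 : 0 < C + 1 by rewrite ltr_wpDl.
have S0 : 0 <= S.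
  by rewrite (le_trans _ (zS (dual_ball0 _)))// sumr_ge0// => y _; exact: powR_ge0.
apply/ler_addgt0Pr => e e0; pose S' := S + e / (C + 1).
have S'0 : 0 < S' by rewrite ltr_wpDl// divr_gt0.
pose l := S' `^ (- p^-1).
have l0 : 0 <= l by exact: powR_ge0.
have lp : l `^ p = S'^-1.
  by rewrite -powRrM mulNr mulVf ?gt_eqF// powR_inv1// ltW.
pose x (j : 'I_(size s)) : dual E := l *: nth 0 s j.
have : \sum_(j < size s) `|f (x j)| `^ p <= C.
  apply: fC; apply/(weak_pnorm_le1 p1) => v v1.
  have i1 : `|bidual_embedding v| <= 1 by rewrite bidual_embedding_norm.
  have := zS (to_dual_ball i1); rewrite (big_nth 0) big_mkord => h.
  under eq_bigr => j _.
    rewrite (_ : x j v = l * nth 0 s j v)// normrM powRM// (ger0_norm l0) lp; over.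
  rewrite -mulr_sumr mulrC ler_pdivrMr// mul1r (le_trans h)// lerDl.
  by rewrite ltW// divr_gt0.
under eq_bigr => j _ do rewrite hf// normrM powRM// (ger0_norm l0) lp.
rewrite -mulr_sumr mulrC ler_pdivrMr// (big_nth 0) big_mkord => /le_trans; apply.
apply: (@le_trans _ _ ((C + 1) * S')); first by rewrite ler_wpM2r ?(ltW S'0)// lerDl.
by rewrite mulrDr (mulrC (C + 1) (e / _)) divfK// gt_eqF.
Qed.

(** The Pietsch domination theorem, with a positive functional on the continuous
    functions on the bidual ball instead of a Radon measure.  The functional is a
    linear minorant of the sublinear functional sending [g] to the infimum of
    [C * S - \sum_(y <- s) |f y|^p] over all [s] and [S] such that
    [g z + \sum_(y <- s) |z y|^p <= S] on the ball; the empty family gives its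
    positivity and a one-element family the domination. *)
Theorem pietsch_domination (f : dual E -> R) : Hp p E f ->
  exists2 L : (K -> R) -> R, positive_functional L &
    forall x, `|f x| <= functional_pnorm p L x.
Proof.
move=> Hf; have [C C0 fC] := Hp_weak_bound Hf.
pose D : set (K -> R^o) := [set g | continuous (g : K -> R)].
have subD : subspace_set D.
  split; first exact: cst_continuous.
  - by move=> g h; exact: continuous_add.
  - by move=> a g; exact: continuous_scale.
pose ok (g : K -> R^o) (c : seq (dual E) * R) : Prop :=
  forall z, g z + \sum_(y <- c.1) `|dual_ball_val z y| `^ p <= c.2.
pose Q g := [set C * c.2 - \sum_(y <- c.1) `|f y| `^ p | c in ok g].
have okD g h c d : ok g c -> ok h d -> ok (g + h) (c.1 ++ d.1, c.2 + d.2).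
  by move=> gc hd z /=; rewrite big_cat/= addrACA lerD.
have lbQ (M : R) g r : (forall z, `|g z| <= M) -> Q g r -> - (C * M) <= r.
  move=> gM [[s S] /= gS <-].
  rewrite lerBrDr addrC -lerBrDr opprK -mulrDr; apply: fC => z.
  by have := gS z; have := gM z; rewrite ler_norml => /andP[]; rewrite /=; lra.
have bd g : D g -> exists2 M : R, 0 <= M & forall z, `|g z| <= M.
  by move=> Dg; apply: compact_continuous_bounded Dg; exact: banach_alaoglu.
have lb g : D g -> has_lbound (Q g).
  by move=> /bd[M _ gM]; exists (- (C * M)) => r; exact: lbQ.
have Qle g c : D g -> ok g c ->
    inf (Q g) <= C * c.2 - \sum_(y <- c.1) `|f y| `^ p.
  by move=> Dg gc; apply: (ge_inf (lb _ Dg)); exists c.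
have sQ : sublinear D (fun g => inf (Q g)).
  apply: (sublinear_inf subD) => //.
  - move=> g /bd[M _ gM]; exists (C * M - \sum_(y <- [::]) `|f y| `^ p).
    exists ([::], M) => // z /=; rewrite big_nil addr0.
    exact: le_trans (ler_norm _) (gM z).
  - move=> g h _ _ _ _ [c gc <-] [d hd <-].
    exists (C * (c.2 + d.2) - \sum_(y <- c.1 ++ d.1) `|f y| `^ p).
      by exists (c.1 ++ d.1, c.2 + d.2) => //; exact: okD.
    by rewrite big_cat/=; lra.
  - move=> t g _ t0 _ [[s S] gS <-]; have [hf _] := Hf.
    pose s' := [seq t `^ p^-1 *: y | y <- s].
    have E1 (h : dual E -> R) : (forall y, h (t `^ p^-1 *: y) = t `^ p^-1 * h y) ->
        \sum_(y <- s') `|h y| `^ p = t * \sum_(y <- s) `|h y| `^ p.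
      move=> hh; rewrite big_map mulr_sumr; apply: eq_bigr => y _.
      by rewrite hh normrM powRM// ger0_norm ?powR_ge0// powRVK// ltW.
    exists (C * (t * S) - \sum_(y <- s') `|f y| `^ p).
      exists (s', t * S) => // z /=; rewrite (E1 (dual_ball_val z)).
        by rewrite -[(t *: g) z]/(t * g z) -mulrDr ler_wpM2l ?(ltW t0).
      by move=> y; rewrite linearZ.
    by rewrite E1/=; [lra|move=> y; rewrite hf// powR_ge0].
have [|||||L [LD LZ Lq _]] := @hahn_banach _ _ D subD _ [set 0] (fun=> 0) sQ.
- by move=> _ ->; have [] := subD.
- by [].
- by move=> _ _ -> ->; split; rewrite /= addr0.
- by move=> t _ _ ->; split; rewrite /= ?scaler0 ?mulr0.
- move=> _ ->; apply: lb_le_inf.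
    exists (C * 0 - \sum_(y <- [::]) `|f y| `^ p), ([::], 0) => // z /=.
    by rewrite big_nil addr0.
  move=> r Qr; rewrite -oppr0 -(mulr0 C); apply: (lbQ _ _ _ _ Qr) => z.
  by rewrite normr0.
have LN g : D g -> L (- g) = - L g.
  by move=> Dg; rewrite -scaleN1r LZ// mulN1r.
have DN g : D g -> D (- g).
  by move=> Dg; rewrite -scaleN1r; have [_ _] := subD; apply.
exists (L : (K -> R) -> R); first split.
- by move=> g h cg ch; exact: LD.
- by move=> a g cg; exact: LZ.
- move=> g cg g0; rewrite -oppr_le0 -LN// (le_trans (Lq _ (DN _ cg)))//.
  have := @Qle (- g) ([::], 0) (DN _ cg); rewrite /= mulr0 big_nil subr0; apply.
  by move=> z /=; rewrite big_nil addr0 oppr_le0.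
move=> x; pose phi : K -> R^o := fun z => `|dual_ball_val z x| `^ p.
have cphi : D phi by exact: continuous_eval_powR.
have fphi : `|f x| `^ p <= L phi.
  rewrite -lerN2 -LN// (le_trans (Lq _ (DN _ cphi)))//.
  have := @Qle (- phi) ([:: x], 0) (DN _ cphi).
  rewrite /= mulr0 big_seq1 sub0r; apply.
  by move=> z; rewrite /= big_seq1 addNr.
rewrite -[leLHS](powRKV p1)//; apply: (ge0_ler_powR _ _ _ fphi).
- by rewrite invr_ge0 ltW.
- by rewrite nnegrE powR_ge0.
- by rewrite nnegrE (le_trans _ fphi)// powR_ge0.
Qed.

End pietsch.

(** * Radon measures and Dirac measures *)

Section radon_functionals.
Context {R : realType} {T : ptopologicalType}.

Lemma continuous_borel_measurable (g : T -> R) :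
  continuous g -> measurable_fun setT (g : borel T -> R).
Proof.
move=> /continuousP cg; apply: (measurability _ (RGenOpens.measurableE R)).
move=> _ [_ [a [b ->] <-]]; rewrite setTI; apply: sub_sigma_algebra.
exact/cg/interval_open.
Qed.

Hypothesis Tcompact : compact [set: T].

Lemma continuous_integrable (mu : {finite_measure set (borel T) -> \bar R})
  (g : T -> R) : continuous g -> mu.-integrable setT (EFin \o (g : borel T -> R)).
Proof.
move=> cg; apply: measurable_bounded_integrable => //.
- exact: fin_num_fun_lty.
- exact: continuous_borel_measurable.
- have [M M0 gM] := compact_continuous_bounded Tcompact cg.
  exists M; split; first exact: num_real.
  by move=> N MN t _; rewrite /= (le_trans (gM t))// ltW.
Qed.

Lemma Rintegral_positive_functional
  (mu : {finite_measure set (borel T) -> \bar R}) :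
  positive_functional (fun g : T -> R => \int[mu]_z (g : borel T -> R) z).
Proof.
split=> [f g cf cg|a f cf|f cf f0].
- by apply: RintegralD => //; exact: continuous_integrable.
- by apply: RintegralZl => //; exact: continuous_integrable.
- by apply: Rintegral_ge0 => z _; exact: f0.
Qed.

Lemma radon_dirac (z : T) : radon (@dirac _ (borel T) z R).
Proof.
move=> A mA.
have dE B : @dirac _ (borel T) z R B = (z \in B)%:R%:E by exact: diracE.
apply/eqP; rewrite eq_le; apply/andP; split.
- rewrite [leLHS]dE; case: (boolP (z \in A)) => zA.
    apply: ereal_sup_ubound; exists [set z].
      by split; [exact: compact_set1|move=> _ ->; exact: set_mem].
    by rewrite [LHS]dE mem_set.
  apply: ereal_sup_ubound; exists set0; first by split; [exact: compact0|].
  by rewrite [LHS]dE in_set0.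
- apply: ub_ereal_sup => _ [B [_ BA] <-]; rewrite [leLHS]dE [leRHS]dE lee_fin ler_nat.
  by have [/set_mem/BA/mem_set ->|] := boolP (z \in B).
Qed.

Lemma Rintegral_dirac (z : T) (g : T -> R) : continuous g ->
  \int[@dirac _ (borel T) z R]_t (g : borel T -> R) t = g z.
Proof.
move=> cg; rewrite /Rintegral integral_dirac//.
  by rewrite diracT mul1e.
by apply/measurable_EFinP; exact: continuous_borel_measurable.
Qed.

End radon_functionals.

(** * Elements of the bidual given by vectors *)

Section bidual.
Context {R : realType}.

(** A functional on the dual that vanishes on the common kernel of finitely many
    vectors is a combination of these vectors. *)
Lemma bidual_of_kernel (V : normedModType R) (s : seq V) (phi : dual (dual V)) :
  (forall x : dual V, (forall v, v \in s -> x v = 0) -> phi x = 0) ->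
  range (@bidual_embedding R V) phi.
Proof.
elim: s phi => [|v s IH] phi phi0.
  exists 0 => //; apply/val_inj/funext => x /=.
  by rewrite /eval_at linear0 phi0.
have [[y [ys yv]]|ny] := pselect (exists y : dual V,
    (forall w, w \in s -> y w = 0) /\ y v != 0).
  pose a := phi y / y v.
  have [|e _ ephi] := IH (phi - a *: bidual_embedding v).
    move=> x xs; have : phi (x - (x v / y v) *: y) = 0.
      apply: phi0 => w; rewrite inE => /orP[/eqP ->|ws].
        by rewrite -[LHS]/(x v - x v / y v * y v) divfK// subrr.
      by rewrite -[LHS]/(x w - x v / y v * y w) (xs w ws) (ys w ws) mulr0 subrr.
    rewrite linearB linearZ /= => h.
    rewrite -[LHS]/(phi x - a * x v) -[RHS]h; congr (_ - _).
    by rewrite /a mulrC mulrA mulrAC.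
  exists (e + a *: v) => //.
  by rewrite -[RHS](subrK (a *: bidual_embedding v)) -ephi addrC
    bidual_embedding_linear addrC.
apply: IH => x xs; apply: phi0 => w; rewrite inE => /orP[/eqP ->|]; last exact: xs.
by apply: contrapT => /eqP xv; apply: ny; exists x.
Qed.

(** By Hahn--Banach, the restriction of [z] to the annihilator of finitely many
    vectors, where it is bounded by [e], extends to a functional [w] with
    [|w| <= e]; then [z - w] is given by a vector. *)
Lemma bidual_approx (V : normedModType R) (z : dual (dual V)) (e : R) :
  0 < e ->
  (\forall u \near dual_ball0 V, `|z (dual_ball_val u)| < e) ->
  exists v, `|z - bidual_embedding v| <= e.
Proof.
move=> e0 /dual_ball_nbhs[s [d [d0 sz]]].
pose N := [set x : dual V | forall v, v \in s -> x v = 0].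
have ND x y : N x -> N y -> N (x + y).
  by move=> Nx Ny v vs; rewrite -[LHS]/(x v + y v) Nx// Ny// addr0.
have NZ a x : N x -> N (a *: x).
  by move=> Nx v vs; rewrite -[LHS]/(a * x v) Nx// mulr0.
have zN x : N x -> z x <= e * `|x|.
  move=> Nx; have [->|x0] := eqVneq x 0; first by rewrite linear0 normr0 mulr0.
  have nx0 : 0 < `|x| by rewrite normr_gt0.
  have x1 : `| `|x|^-1 *: x| <= 1 by rewrite normfZV.
  have := sz (to_dual_ball x1); rewrite /= => h.
  have {h} : `|z (`|x|^-1 *: x)| < e.
    apply: h => v vs.
    rewrite [X in _ - X](NZ `|x|^-1 _ Nx _ vs) [X in X - _](_ : _ = 0)//.
    by rewrite subr0 normr0.
  rewrite linearZ normrM ger0_norm ?invr_ge0// mulrC ltr_pdivrMr// => /ltW.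
  exact/le_trans/ler_norm.
have [|||||f [fD fZ fe zf]] := @hahn_banach _ _ setT (subspace_setT _)
  (fun x => e * `|x|) N z (sublinear_norm (ltW e0)).
- by [].
- by move=> v _.
- by move=> x y Nx Ny; split; [exact: ND|rewrite linearD].
- by move=> t x _ Nx; split; [exact: NZ|rewrite linearZ].
- exact: zN.
have [|||w wf we] := @dual_of_bounded _ _ f e (ltW e0).
- by move=> x y; exact: fD.
- by move=> a x; exact: fZ.
- by move=> x; exact: fe.
have [|v _ vzw] := @bidual_of_kernel _ s (z - w).
  move=> x Nx; rewrite -[LHS]/(z x - w x) wf; apply/eqP.
  rewrite eq_le subr_le0 zf//= subr_ge0 -lerN2 -linearN -mulN1r -fZ// scaleN1r.
  by apply: zf; rewrite -scaleN1r; exact: NZ.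
by exists v; rewrite vzw opprB addrCA subrr addr0.
Qed.

(** The canonical image of a Banach space in its bidual is closed. *)
Lemma range_bidual_closed (V : completeNormedModType R) (z : dual (dual V)) :
  (forall e, 0 < e -> exists v, `|z - bidual_embedding v| <= e) ->
  range (@bidual_embedding R V) z.
Proof.
move=> zV; pose r n : R := n.+1%:R^-1.
have /choice[v vP] : forall n, exists v, `|z - bidual_embedding v| <= r n.
  by move=> n; apply: zV; rewrite invr_gt0.
have vB x y : `|x - y| = `|bidual_embedding x - bidual_embedding y : dual (dual V)|.
  rewrite -bidual_embedding_norm; congr (`| _ |).
  by apply/val_inj/funext => f /=; rewrite /eval_at linearB.
have : cvg (v n @[n --> \oo]).
  apply/cauchy_cvgP/cauchy_exP => e e0.
  have e20 : 0 < e / 2 by rewrite divr_gt0.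
  have [N _ Nr] := near_infty_natSinv_lt (PosNum e20).
  exists (v N), N => // n /= Nn; rewrite -ball_normE /= vB.
  rewrite -(subrKA z) (le_lt_trans (ler_normD _ _))// [ltRHS]splitr.
  rewrite ltrD// ?(le_lt_trans (vP n))// ?Nr//.
  by rewrite distrC (le_lt_trans (vP N))// Nr/=.
move=> /cvg_ex[l vl]; exists l => //; apply/esym/eqP.
rewrite -subr_eq0 -normr_le0; apply/ler_addgt0Pr => e e0; rewrite add0r.
have e20 : 0 < e / 2 by rewrite divr_gt0.
near \oo => n.
rewrite -(subrKA (bidual_embedding (v n))) (le_trans (ler_normD _ _))//.
rewrite [leRHS]splitr lerD//.
  rewrite (le_trans (vP n))//; apply/ltW; near: n.
  exact: near_infty_natSinv_lt (PosNum e20).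
rewrite -vB distrC; apply/ltW; near: n.
exact: cvgr_dist_lt.
Unshelve. all: by end_near. Qed.

Lemma reflexive_of_continuous_at0 (V : completeNormedModType R) :
  (forall (z : dual_ball (dual V)) e, 0 < e ->
     \forall u \near dual_ball0 V, `|dual_ball_val z (dual_ball_val u)| < e) ->
  reflexive_space V.
Proof.
move=> zc; apply/seteqP; split=> // z _.
have [->|z0] := eqVneq z 0.
  by exists 0 => //; apply/val_inj/funext => f /=; rewrite /eval_at linear0.
have z1 : `| `|z|^-1 *: z| <= 1 by rewrite normfZV.
have [|v _ vz] := @range_bidual_closed V (`|z|^-1 *: z).
  by move=> e e0; apply: bidual_approx => //; exact: (zc (to_dual_ball z1)).
exists (`|z| *: v) => //; apply/val_inj/funext => f /=.
have -> : eval_at (`|z| *: v) f = `|z| * bidual_embedding v f.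
  by rewrite /eval_at linearZ.
rewrite vz -[X in _ * X]/(`|z|^-1 * z f) mulrA mulfV ?mul1r//.
by rewrite normr_eq0.
Qed.

End bidual.

(** * The functions of Radon measures and reflexivity *)

Section fmu.
Context {R : realType} (p : R) (p1 : 1 <= p).

Lemma fmu_Hp (E : normedModType R)
    (mu : {finite_measure set (borel (dual_ball (dual E))) -> \bar R}) :
  Hp p E (fmu p mu).
Proof.
apply: (functional_pnorm_Hp p1).
exact: (Rintegral_positive_functional (@banach_alaoglu R (dual E))).
Qed.

Lemma fmu_dirac (E : normedModType R) (z : dual_ball (dual E)) (x : dual E) :
  fmu p (@dirac _ (borel (dual_ball (dual E))) z R) x = `|dual_ball_val z x|.
Proof.
rewrite /fmu (Rintegral_dirac z (continuous_eval_powR p1 (x := x))).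
by rewrite powRKV.
Qed.

(** Weak* continuity at 0 of the functions of Dirac measures gives reflexivity. *)
Lemma reflexive_of_Mpw0 (E : completeNormedModType R) :
  (forall mu : {finite_measure set (borel (dual_ball (dual E))) -> \bar R},
     radon mu -> Mpw0 p E (fmu p mu)) -> reflexive_space E.
Proof.
move=> fM; apply: reflexive_of_continuous_at0 => z e e0.
have [[hf _] /(cvg_at0P hf)/(_ e e0)] := fM _ (radon_dirac z).
apply: filterS => u; rewrite (fmu_dirac z) normr_id.
by [].
Qed.

End fmu.

Theorem theorem5p5 (R : realType) (p : R) (p1 : 1 <= p)
    (E : completeNormedModType R) :
  [<-> reflexive_space E;
       forall mu : {finite_measure set (borel (dual_ball (dual E))) -> \bar R},
         radon mu -> Hw E (fmu p mu);
       Hp p E = Jpw p E;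
       Hp p E = FBL_closure p (Jpw p E);
       forall mu : {finite_measure set (borel (dual_ball (dual E))) -> \bar R},
         radon mu -> Mpw0 p E (fmu p mu)].
Proof.
tfae.
- move=> Erefl mu _; apply: (functional_pnorm_Hw p1) => //.
  exact: (Rintegral_positive_functional (@banach_alaoglu R (dual E))).
- (* the domination theorem supplies a functional, not a measure, so the hypothesis
     is used through reflexivity *)
  move=> fmuw; have Erefl : reflexive_space E.
    apply: (reflexive_of_Mpw0 p1) => mu rmu; split; first exact: fmu_Hp.
    by have [_ cf] := fmuw mu rmu; exact: cf.
  apply/seteqP; split; last exact: Jpw_sub_Hp.
  move=> f Hf; have [L Lpos fL] := pietsch_domination p1 Hf.
  move=> I [[_ _ _ _ Idom] HI].
  apply: (Idom _ (functional_pnorm p L)) => //.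
    apply: HI; split; first exact: functional_pnorm_Hp.
    exact: functional_pnorm_Hw.
  by move=> x; rewrite [leRHS]ger0_norm// powR_ge0.
- move=> HJ; apply/seteqP; split; last by move=> f [].
  by rewrite {1}HJ; apply: sub_FBL_closure => //; exact: Jpw_sub_Hp.
- move=> HJ mu _; apply: (Mpw0_closed p1).
  have : FBL_closure p (Jpw p E) (fmu p mu) by rewrite -HJ; exact: fmu_Hp.
  move=> [Hf fcl]; split=> // e e0; have [g Jg fg] := fcl e e0.
  by exists g; [exact: (Jpw_sub_Mpw0 p1 Jg)|exact: fg].
- exact: (reflexive_of_Mpw0 p1).
Qed.
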